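(* Let $s\ge 1$ and let $R>1$, $N>1$, $q$, $p_1,\dots,p_s$ be positive integers with $\gcd(R,N)=1$ and $p_1<p_2<\cdots<p_s<q$. Let $M=RN^q$ and $$D=\{0,1,\dots,N-1\}\oplus N^{p_1}\{0,1,\dots,N-1\}\oplus\cdots\oplus N^{p_s}\{0,1,\dots,N-1\}.$$ Then the self-similar measure $\mu_{M,D}$ is a spectral measure, with a spectrum $$\Lambda=\left\{\sum_{j=1}^{k}(RN^q)^{j-1}l_j : k\ge 1 \text{ and all } l_j\in L\right\},$$ where $$L=RN^q\left(\frac{1}{N}\{0,1,\dots,N-1\}\oplus\frac{1}{N^{p_1+1}}\{0,1,\dots,N-1\}\oplus\cdots\oplus\frac{1}{N^{p_s+1}}\{0,1,\dots,N-1\}\right).$$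
   Context: $A\oplus B=\{a+b: a\in A, b\in B\}$ denotes the sumset, where all sums $a+b$ are distinct. The self-similar measure $\mu_{M,D}$ is the unique Borel probability measure on $\mathbb{R}$ satisfying $\mu_{M,D}(E)=\frac{1}{\#D}\sum_{d\in D}\mu_{M,D}(\tau_d^{-1}(E))$ for every Borel set $E\subset\mathbb{R}$, where $\tau_d(x)=M^{-1}(x+d)$; it is compactly supported. A compactly supported Borel probability measure $\mu$ on $\mathbb{R}$ is a spectral measure if there is a countable discrete set $\Lambda\subset\mathbb{R}$ such that $\{e^{2\pi i\lambda x}:\lambda\in\Lambda\}$ is an orthonormal basis of $L^2(\mu)$; then $\Lambda$ is called a spectrum of $\mu$. *)

(* Defs.v *)
From HB Require Import structures.
From mathcomp Require Import all_boot all_order all_algebra finmap complex.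
From mathcomp Require Import all_classical all_reals all_analysis.

Set Implicit Arguments.
Unset Strict Implicit.
Unset Printing Implicit Defensive.

Import Order.TTheory GRing.Theory Num.Theory.
Import numFieldNormedType.Exports.
Local Open Scope classical_set_scope.
Local Open Scope ring_scope.

Definition digits (K : realType) (N : nat) : {fset K} :=
  [fset (k%:R)%R | k in iota 0 N]%fset.

Definition dilate (K : realType) (c : K) (A : {fset K}) : {fset K} :=
  [fset (c * a)%R | a in A]%fset.

Definition sumset (K : realType) (A B : {fset K}) : {fset K} :=
  [fset (a + b)%R | a in A, b in B]%fset.

(* The notation A (+) B carries the assertion that all sums a + b are
   distinct; the set is [sumset A B] and the assertion is [direct A B]. *)
Definition direct (K : realType) (A B : {fset K}) : Prop :=
  forall a a' b b', a \in A -> a' \in A -> b \in B -> b' \in B ->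
    a + b = a' + b' -> a = a' /\ b = b'.

Definition sumsets (K : realType) (As : seq {fset K}) : {fset K} :=
  foldr (@sumset K) [fset 0]%fset As.

Fixpoint directs (K : realType) (As : seq {fset K}) : Prop :=
  if As is A :: As' then direct A (sumsets As') /\ directs As' else True.

Definition self_similar_measure (K : realType) (M : K) (D : {fset K})
    (mu : probability (measurableTypeR K) K) : Prop :=
  forall E : set (measurableTypeR K), measurable E ->
    mu E = ((#|` D|%:R^-1)%:E *
            \sum_(d <- D) mu ((fun x : K => (M^-1 * (x + d))%R) @^-1` E))%E.

Section complex_L2.
Context {d : measure_display} {T : measurableType d} {K : realType}.
Variable mu : {measure set T -> \bar K}.

Definition normL2 (f : T -> K[i]) : \bar K :=
  'N[mu]_2%:E[(fun x => (ComplexField.Normc.normc (f x))%:E)].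

Definition inL2 (f : T -> K[i]) : Prop :=
  [/\ measurable_fun setT (fun x => complex.Re (f x)),
      measurable_fun setT (fun x => complex.Im (f x)) &
      (normL2 f < +oo)%E].

Definition dotL2 (f g : T -> K[i]) : K[i] :=
  let h := fun x => f x * (g x)^*%C in
  Complex (\int[mu]_x complex.Re (h x)) (\int[mu]_x complex.Im (h x)).

(* Orthonormal family, indexed by the set A, whose linear span is dense. *)
Definition orthonormal_basis (I : choiceType) (A : set I)
    (e : I -> T -> K[i]) : Prop :=
  [/\ forall i, A i -> inL2 (e i),
      forall i j, A i -> A j -> dotL2 (e i) (e j) = (i == j)%:R &
      forall f, inL2 f -> forall eps : K, 0 < eps ->
        exists (r : seq I) (c : I -> K[i]),
          (forall i, i \in r -> A i) /\
          (normL2 (fun x => (f x - \sum_(i <- r) c i * e i x)%R) < eps%:E)%E].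

End complex_L2.

(* x |-> exp (2 pi i lambda x) *)
Definition character_fun (K : realType) (lambda x : K) : K[i] :=
  Complex (cos (2 * pi * lambda * x)) (sin (2 * pi * lambda * x)).

Definition measure_support (K : realType)
    (mu : probability (measurableTypeR K) K) : set K :=
  [set x | forall U : set K, open U -> U x -> (0 < mu U)%E].

Definition is_spectrum (K : realType)
    (mu : probability (measurableTypeR K) K) (Lambda : set K) : Prop :=
  [/\ countable Lambda, Lambda `<=` isolated Lambda &
      orthonormal_basis mu Lambda (@character_fun K)].

Definition spectral_measure (K : realType)
    (mu : probability (measurableTypeR K) K) : Prop :=
  compact (measure_support mu) /\ exists Lambda, is_spectrum mu Lambda.

(* Main.v *)
Require Import Defs.
From HB Require Import structures.
From mathcomp Require Import all_boot all_order all_algebra finmap complex.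
From mathcomp Require Import all_classical all_reals all_analysis.
From mathcomp Require Import measurable_realfun ring lra.

(** The measure is the level-k average of its copies at the points x of
    X_k = M^-1 D + ... + M^-k D, scaled by M^-k. The sets X_k and
    Y_k = L + M L + ... + M^(k-1) L are in duality: the matrix e(xy), x in X_k,
    y in Y_k, is N^(k(s+1)/2) times a unitary matrix, because the digits and the
    frequencies pair triangularly. Orthogonality of the exponentials follows at once.
    For completeness, approximate a square integrable function by a function g
    constant on the M-adic cells of level k, and expand g on X_k in the frequencies
    of Y_k. As R > 1, the measure lives on an interval [0, h] with h < 1/2, so inside
    a cell each frequency of Y_k turns by an angle less than pi; after recentring
    the phases and multiplying the Fourier sum by c = cos (pi h) > 0, its distance
    to g is at most sqrt (1 - c^2) |g|. Iterating this contraction on the remainder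
    shows that the span of the exponentials is dense. *)

Set Implicit Arguments.
Unset Strict Implicit.
Unset Printing Implicit Defensive.

Import Order.TTheory GRing.Theory Num.Theory.
Import numFieldNormedType.Exports.
Local Open Scope classical_set_scope.
Local Open Scope ring_scope.

(** * Complex exponentials and sums over roots of unity *)

Section Characters.
Variable K : realType.
Implicit Types t : K.

(** The duality is only one-sided: N^e' N^-(e+1) is an integer for e' > e, and M N^-(e+1) is an
    integer because e < q, while the reverse pairings are fractional. The Fourier matrix is
    therefore not a tensor product, yet summing out one step at a time in the right direction still
    factors every sum.

    The bound h = (N^q - 1) / (M - 1) is the sum over j >= 1 of M^-j times the largest digit allowed
    by the exponents below q. The multiplier c is the best scalar: the bound 1 - 2 t c + t^2 for |1
    - t e^(i theta)|^2, valid when cos theta >= c, is least at t = c.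

    The obstacle to iterating is that exponentials are not constant on cells, so the remainder after
    one round is no longer cellwise and has to be approximated afresh, at a level over which there
    is no control. This is harmless because the factor 1 - c^2 depends on h alone and not on the
    level, and its distance to 1 leaves room for the approximation error. *)

Definition cis t : K[i] := Complex (cos (2 * pi * t)) (sin (2 * pi * t)).

Lemma cisD t u : cis (t + u) = cis t * cis u.
Proof.
rewrite /cis mulrDr cosD sinD; apply/eqP; rewrite eq_complex /= eqxx /=.
by apply/eqP; rewrite addrC [cos _ * sin _ in LHS]mulrC mulrC [X in _ + X]mulrC addrC.
Qed.

Lemma cis0 : cis 0 = 1.
Proof. by rewrite /cis mulr0 cos0 sin0. Qed.

Lemma conj_cis t : (cis t)^*%C = cis (- t).
Proof. by rewrite /cis /= mulrN cosN sinN. Qed.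

Lemma cisM_conj t u : cis t * (cis u)^*%C = cis (t - u).
Proof. by rewrite conj_cis cisD. Qed.

Lemma cis1 : cis 1 = 1.
Proof. by rewrite /cis mulr1 mulr_natl cos2pi sin2pi. Qed.

Lemma cis_mulrn t n : cis (t * n%:R) = cis t ^+ n.
Proof.
elim: n => [|n IH]; first by rewrite mulr0 cis0 expr0.
by rewrite -natr1 mulrDr mulr1 cisD IH exprSr.
Qed.

Lemma cis_int t : t \is a Num.int -> cis t = 1.
Proof.
have nat1 n : cis n%:R = 1 by rewrite -[n%:R]mul1r cis_mulrn cis1 expr1n.
case/intrP => -[n|n] ->; first by rewrite -pmulrn nat1.
by rewrite NegzE rmorphN /= -conj_cis -pmulrn nat1 /= oppr0.
Qed.

Lemma cis_intD t u : t \is a Num.int -> cis (t + u) = cis u.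
Proof. by move=> ht; rewrite cisD cis_int// mul1r. Qed.

(** The double angle formula turns cos (2 pi t) = 1 into sin (pi t) = 0, impossible for 0 < t <
    1. *)
Lemma cis_neq1 t : 0 < t < 1 -> cis t != 1.
Proof.
move=> /andP[t0 t1]; apply/eqP => -[+ _].
rewrite -mulrA mulr_natl cos_mulr2n => h.
have s0 : 0 < sin (pi * t).
  by apply: sin_gt0_pi; rewrite mulr_gt0 ?pi_gt0//= gtr_pMr ?pi_gt0.
have := cos2Dsin2 (pi * t).
have : 0 < sin (pi * t) ^+ 2 by rewrite exprn_gt0.
move: h; rewrite mulr2n; lra.
Qed.

Lemma cis_frac_neq1 (N m m' : nat) : (m < N)%N -> (m' < N)%N -> m != m' ->
  cis ((m%:R - m'%:R) / N%:R) != 1.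
Proof.
wlog lt : m m' / (m' < m)%N => [hw mN m'N mm'|mN _ _].
  move: (mm'); rewrite neq_ltn => /orP[lt|lt]; last exact: hw.
  apply: contra (hw m' m lt m'N mN _) => [/eqP e|]; last by rewrite eq_sym.
  by rewrite -opprB mulNr -conj_cis e /= oppr0.
apply: cis_neq1; have N0 : (0 : K) < N%:R by rewrite ltr0n (leq_ltn_trans _ mN).
rewrite divr_gt0 ?subr_gt0 ?ltr_nat//= ltr_pdivrMr// mul1r.
rewrite -natrB ?ltr_nat; last exact: ltnW.
by rewrite (leq_ltn_trans (leq_subr _ _)).
Qed.

(** A geometric sum over the powers of a nontrivial N-th root of unity: multiplied by [cis t - 1] it
    telescopes to [cis t ^+ N - 1], which is 0. *)
Lemma sum_cis_frac (N m m' : nat) : (m < N)%N -> (m' < N)%N -> m != m' ->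
  \sum_(k <- iota 0 N) cis (k%:R * ((m%:R - m'%:R) / N%:R)) = 0.
Proof.
move=> mN m'N mm'; set t := (_ / _).
have t1 : cis t - 1 != 0 by rewrite subr_eq0; exact: cis_frac_neq1.
apply: (mulfI t1); rewrite mulr0.
have -> : \sum_(k <- iota 0 N) cis (k%:R * t) = \sum_(i < N) cis t ^+ i.
  rewrite -{1}(subn0 N) big_mkord; apply: eq_bigr => i _.
  by rewrite mulrC cis_mulrn.
rewrite -subrX1 -cis_mulrn /t mulfVK ?pnatr_eq0; last by case: N mN {t t1 m'N}.
by rewrite cis_int ?subrr// rpredB// ?natr_int.
Qed.

End Characters.

(** * Digit combinations and the triangular duality *)

Section Combinations.
Variables (K : realType) (N : nat).
Hypothesis N_gt0 : (0 < N)%N.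
Implicit Types (us bs : seq K) (x y : K).

(** A list with multiplicities, so that sums over it split along the steps before the combinations
    are known to be distinct; distinctness is later drawn from the duality. *)
Fixpoint comb us : seq K :=
  if us is a :: us' then [seq a * k%:R + x | k <- iota 0 N, x <- comb us']
  else [:: 0].

Lemma combP a us x : reflect
  (exists k x', [/\ (k < N)%N, x' \in comb us & x = a * k%:R + x'])
  (x \in comb (a :: us)).
Proof.
apply: (iffP allpairsP) => [[[k x'] /= []]|[k [x' [kN x'c ->]]]].
  by rewrite mem_iota /= add0n => kN x'c ->; exists k, x'.
by exists (k, x'); rewrite mem_iota.
Qed.

Lemma size_comb us : size (comb us) = (N ^ size us)%N.
Proof.
by elim: us => //= a us IH; rewrite size_allpairs size_iota IH expnS.
Qed.

Lemma big_comb (R : Type) (idx : R) (op : Monoid.law idx) a us (F : K -> R) :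
  \big[op/idx]_(x <- comb (a :: us)) F x =
  \big[op/idx]_(k <- iota 0 N) \big[op/idx]_(x <- comb us) F (a * k%:R + x).
Proof. exact: big_allpairs_dep. Qed.

Lemma mem_comb_cat us bs x y :
  x \in comb us -> y \in comb bs -> x + y \in comb (us ++ bs).
Proof.
elim: us x => [|a us IH] x.
  by rewrite inE => /eqP ->; rewrite add0r.
move=> /combP[k [x' [kN x'c ->]]] yb; apply/combP.
by exists k, (x' + y); rewrite IH// addrA.
Qed.

Lemma comb_catP us bs z : z \in comb (us ++ bs) ->
  exists x y, [/\ x \in comb us, y \in comb bs & z = x + y].
Proof.
elim: us z => [|a us IH] z /=.
  by exists 0, z; rewrite inE eqxx add0r.
move=> /combP[k [z' [kN /IH[x [y [xc yc ->]]] ->]]].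
by exists (a * k%:R + x), y; rewrite addrA; split=> //; apply/combP; exists k, x.
Qed.

Lemma comb_int us b x : (forall a, a \in us -> a * b \is a Num.int) ->
  x \in comb us -> x * b \is a Num.int.
Proof.
elim: us x => [|a us IH] x ab.
  by rewrite inE => /eqP ->; rewrite mul0r rpred0.
move=> /combP[k [x' [kN x'c ->]]]; rewrite mulrDl rpredD//.
  by rewrite mulrAC rpredM ?natr_int// ab ?mem_head.
by apply: IH => // a' a'us; rewrite ab// inE a'us orbT.
Qed.

Lemma comb_mul c us : comb [seq c * a | a <- us] = [seq c * x | x <- comb us].
Proof.
elim: us => [|a us IH] /=; first by rewrite mulr0.
rewrite IH map_allpairs allpairs_mapr; apply: eq_allpairs => k x.
by rewrite mulrDr mulrA.
Qed.

(* A triangular duality: the pairing of the entry [a] with the entry [b] at the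
   same place is 1/N, and later entries of [us] pair integrally with [b]. No
   condition is put on the pairings of [a] with later entries of [bs]. *)
Fixpoint dual_frames us bs : Prop :=
  match us, bs with
  | a :: us', b :: bs' =>
      [/\ a * b = N%:R^-1, forall a', a' \in us' -> a' * b \is a Num.int
        & dual_frames us' bs']
  | [::], [::] => True
  | _, _ => False
  end.

Lemma dual_frames_size us bs : dual_frames us bs -> size us = size bs.
Proof. by elim: us bs => [|a us IH] [|b bs]//= [_ _ /IH ->]. Qed.

(** Points of the tail pair integrally with the head frequency b, so the sum is a product of a sum
    over the head digit and the Gram sum of the tails. If the tails of y and y' differ, the second
    factor vanishes by induction; if they agree, the first is a vanishing geometric sum. *)
Lemma dual_frames_gram us bs y y' : dual_frames us bs ->
  y \in comb bs -> y' \in comb bs ->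
  \sum_(x <- comb us) cis (x * (y - y')) = (y == y')%:R * (N ^ size us)%:R.
Proof.
have gram_diag z : \sum_(x <- comb us) cis (x * (z - z)) = (N ^ size us)%:R.
  under eq_bigr do rewrite subrr mulr0 cis0.
  by rewrite big_const_seq iter_addr_0 count_predT size_comb.
have [->|yy'] := eqVneq y y'; first by rewrite gram_diag mul1r.
rewrite mul0r; clear gram_diag; elim: us bs y y' yy' => [|a us IH] [|b bs]//= y y' yy'.
  by rewrite !inE => _ /eqP e /eqP e'; rewrite e e' eqxx in yy'.
move=> [ab a'b df] /combP[m [z [mN zc ey]]] /combP[m' [z' [m'N z'c ey']]].
rewrite big_comb.
under eq_bigr => k _.
  under eq_bigr do rewrite mulrDl cisD.
  rewrite -mulr_sumr.
  have -> : \sum_(x <- comb us) cis (x * (y - y')) =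
            \sum_(x <- comb us) cis (x * (z - z')).
    apply: eq_big_seq => x xc.
    rewrite (_ : x * (y - y') = x * b * (m%:R - m'%:R) + x * (z - z')).
      by rewrite cis_intD// rpredM ?rpredB ?natr_int// (comb_int a'b).
    by rewrite ey ey'; ring.
  over.
rewrite -mulr_suml.
have [zz'|zz'] := eqVneq z z'; last by rewrite (IH bs) ?mulr0.
have mm' : m != m' by apply: contra yy' => /eqP e; rewrite ey ey' zz' e.
rewrite (_ : \sum_(i <- iota 0 N) _ = 0) ?mul0r//.
rewrite -[RHS](sum_cis_frac K mN m'N mm'); apply: eq_bigr => k _.
congr cis; rewrite ey ey' zz' -ab; ring.
Qed.

(** A direct induction, with no appeal to matrix inversion. If the head digits agree, the tails
    differ and the inner sum vanishes by induction; otherwise, modulo 1, the head frequency digit m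
    meets only m (k - k') / N and the outer sum vanishes. *)
Lemma dual_frames_gramT us bs x x' : dual_frames us bs ->
  x \in comb us -> x' \in comb us ->
  \sum_(y <- comb bs) cis ((x - x') * y) = (x == x')%:R * (N ^ size bs)%:R.
Proof.
have [->|xx'] := eqVneq x x'.
  move=> _ _ _; rewrite mul1r; under eq_bigr do rewrite subrr mul0r cis0.
  by rewrite big_const_seq iter_addr_0 count_predT size_comb.
rewrite mul0r; elim: us bs x x' xx' => [|a us IH] [|b bs]//= x x' xx'.
  by rewrite !inE => _ /eqP e /eqP e'; rewrite e e' eqxx in xx'.
move=> [ab a'b df] /combP[k [z [kN zc ex]]] /combP[k' [z' [k'N z'c ex']]].
rewrite big_comb.
have [kk'|kk'] := eqVneq k k'.
  have zz' : z != z' by apply: contra xx' => /eqP e; rewrite ex ex' kk' e.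
  apply: big1 => m _; under eq_bigr do rewrite mulrDr cisD.
  have -> : x - x' = z - z' by rewrite ex ex' kk'; ring.
  by rewrite -mulr_sumr (IH bs) ?mulr0.
under eq_bigr => m _.
  under eq_bigr do rewrite mulrDr cisD.
  rewrite -mulr_sumr
    (_ : _ * (b * m%:R) = (z - z') * b * m%:R + m%:R * ((k%:R - k'%:R) / N%:R)).
    rewrite cis_intD; last by
      rewrite mulrBl rpredM ?natr_int// rpredB// (comb_int a'b).
    over.
  by rewrite ex ex' -ab; ring.
by rewrite -mulr_suml sum_cis_frac// mul0r.
Qed.

(** Multiplied by b and reduced modulo 1, the equation leaves (k - k') / N, so the head digits
    agree. *)
Lemma dual_frames_injl a us b bs k k' x x' : dual_frames (a :: us) (b :: bs) ->
  (k < N)%N -> (k' < N)%N -> x \in comb us -> x' \in comb us ->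
  a * k%:R + x = a * k'%:R + x' -> k = k' /\ x = x'.
Proof.
move=> [ab a'b _] kN k'N xc x'c e.
have kk' : k = k'.
  apply/eqP; apply: contraTT isT => /(cis_frac_neq1 K kN k'N)/negP[].
  have -> : (k%:R - k'%:R) / N%:R = (x' - x) * b.
    have -> : x' - x = a * k%:R - a * k'%:R by move: e; lra.
    by rewrite -ab; ring.
  by rewrite cis_int// mulrBl rpredB// (comb_int a'b).
by split=> //; move: e; rewrite kk' => /addrI.
Qed.

(** Nothing is known about a against the later frequencies, so the tails are compared first: for
    distinct y and y' the Gram sum would vanish, but y - y' is an integer multiple of b and each of
    its terms is 1. *)
Lemma dual_frames_injr a us b bs k k' y y' : dual_frames (a :: us) (b :: bs) ->
  (k < N)%N -> (k' < N)%N -> y \in comb bs -> y' \in comb bs ->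
  b * k%:R + y = b * k'%:R + y' -> k = k' /\ y = y'.
Proof.
move=> [ab a'b df] kN k'N yc y'c e.
have b0 : b != 0.
  apply/eqP => b0; move: ab; rewrite b0 mulr0 => /esym/eqP.
  by rewrite invr_eq0 pnatr_eq0 gtn_eqF.
have yy' : y = y'.
  apply/eqP; apply: contraTT isT => /negPf yy'.
  have := dual_frames_gram df yc y'c; rewrite yy' mul0r.
  under eq_big_seq => x xc.
    have -> : x * (y - y') = x * b * (k'%:R - k%:R).
      have -> : y - y' = b * k'%:R - b * k%:R by move: e; lra.
      by ring.
    rewrite cis_int; first over.
    by rewrite rpredM ?rpredB ?natr_int// (comb_int a'b).
  rewrite big_const_seq iter_addr_0 count_predT size_comb => /eqP.
  by rewrite pnatr_eq0 expn_eq0 gtn_eqF.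
split=> //; move: e; rewrite yy' => /addIr/(mulfI b0)/eqP.
by rewrite eqr_nat => /eqP.
Qed.

Lemma dual_frames_uniql us bs : dual_frames us bs -> uniq (comb us).
Proof.
elim: us bs => [|a us IH] [|b bs]// df.
apply: allpairs_uniq; [exact: iota_uniq|exact: IH (let: And3 _ _ h := df in h)|].
move=> [k x] [k' x'] /allpairsP[[k0 x0] [/=]] + h2 [-> ->].
move=> + /allpairsP[[k1 x1] [/=]] + h4 [-> ->].
rewrite !mem_iota/= !add0n => h1 h3 e.
by have [-> ->] := dual_frames_injl df h1 h3 h2 h4 e.
Qed.

Lemma dual_frames_uniqr us bs : dual_frames us bs -> uniq (comb bs).
Proof.
elim: us bs => [|a us IH] [|b bs]// df.
apply: allpairs_uniq; [exact: iota_uniq|exact: IH (let: And3 _ _ h := df in h)|].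
move=> [k x] [k' x'] /allpairsP[[k0 x0] [/=]] + h2 [-> ->].
move=> + /allpairsP[[k1 x1] [/=]] + h4 [-> ->].
rewrite !mem_iota/= !add0n => h1 h3 e.
by have [-> ->] := dual_frames_injr df h1 h3 h2 h4 e.
Qed.

End Combinations.

(** * Squared modulus and the finite Fourier transform *)

Section SquaredModulus.
Variable K : realType.
Implicit Types z w : K[i].

Definition sqmod z : K := complex.Re z ^+ 2 + complex.Im z ^+ 2.

Lemma sqmodE z : (sqmod z)%:C%C = z * z^*%C.
Proof.
case: z => a b; apply/eqP; rewrite eq_complex /sqmod /=.
by apply/andP; split; apply/eqP; ring.
Qed.

Lemma sqmod_ge0 z : 0 <= sqmod z.
Proof. by rewrite addr_ge0 ?sqr_ge0. Qed.

Lemma sqmodM z w : sqmod (z * w) = sqmod z * sqmod w.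
Proof. by case: z w => a b [c d]; rewrite /sqmod /=; ring. Qed.

Lemma sqmod_cis t : sqmod (@cis K t) = 1.
Proof. by rewrite /sqmod /= cos2Dsin2. Qed.

(** The square of d x - y absorbs the cross term in each coordinate. The free weight d keeps the
    factor of the main term close to 1, so that a contraction survives a small perturbation. *)
Lemma sqmodD_le (d : K) z w : 0 < d ->
  sqmod (z + w) <= (1 + d) * sqmod z + (1 + d^-1) * sqmod w.
Proof.
case: z w => a b [a' b'] d0; rewrite /sqmod /=.
have aux (x y : K) : (x + y) ^+ 2 <= (1 + d) * x ^+ 2 + (1 + d^-1) * y ^+ 2.
  have : 0 <= d^-1 * (d * x - y) ^+ 2 by rewrite mulr_ge0 ?sqr_ge0// invr_ge0 ltW.
  have -> : d^-1 * (d * x - y) ^+ 2 = d * x ^+ 2 - 2 * x * y + d^-1 * y ^+ 2.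
    by field; rewrite gt_eqF.
  lra.
have := aux a a'; have := aux b b'; lra.
Qed.

End SquaredModulus.

Section DiscreteFourier.
Variables (K : realType) (N : nat) (us bs : seq K).
Hypothesis N_gt0 : (0 < N)%N.
Hypothesis us_bs : dual_frames N us bs.

Definition dft (g : K -> K[i]) (l : K) : K[i] :=
  (N ^ size us)%:R^-1 * \sum_(x <- comb N us) g x * cis (- (x * l)).

Let card_neq0 : (N ^ size us)%:R != 0 :> K[i].
Proof. by rewrite pnatr_eq0 expn_eq0 gtn_eqF. Qed.

Lemma dft_inversion g x : x \in comb N us ->
  \sum_(l <- comb N bs) dft g l * cis (x * l) = g x.
Proof.
move=> xc; transitivity ((N ^ size us)%:R^-1 * \sum_(x' <- comb N us)
    g x' * \sum_(l <- comb N bs) cis ((x - x') * l)).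
  under eq_bigr do rewrite /dft -mulrA mulr_suml.
  rewrite -mulr_sumr exchange_big; congr (_ * _); apply: eq_bigr => x' _.
  rewrite mulr_sumr; apply: eq_bigr => l _.
  by rewrite -mulrA -cisD mulrBl addrC.
under eq_big_seq => x' x'c do rewrite (dual_frames_gramT us_bs xc x'c).
rewrite (bigD1_seq x xc (dual_frames_uniql us_bs)) /= big1 => [|x' x'x]; last first.
  by rewrite eq_sym (negPf x'x) mul0r mulr0.
by rewrite eqxx mul1r addr0 -(dual_frames_size us_bs) mulrC mulfK.
Qed.

(** Stated for arbitrary coefficients and not just those of [dft]: the contraction compares two such
    sums with different coefficients. *)
Lemma plancherel (c : K -> K[i]) :
  \sum_(x <- comb N us) sqmod (\sum_(l <- comb N bs) c l * cis (x * l)) =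
  (N ^ size us)%:R * \sum_(l <- comb N bs) sqmod (c l).
Proof.
apply: (@complexI K).
rewrite rmorphM !rmorph_sum/= rmorph_nat.
under eq_bigr do rewrite sqmodE rmorph_sum big_distrlr /=.
rewrite exchange_big /= mulr_sumr; apply: eq_big_seq => l lc.
rewrite exchange_big /= sqmodE.
transitivity (\sum_(l' <- comb N bs) c l * (c l')^*%C *
    \sum_(x <- comb N us) cis (x * (l - l'))).
  apply: eq_bigr => l' _; rewrite mulr_sumr; apply: eq_bigr => x _.
  by rewrite rmorphM /= mulrACA cisM_conj mulrBr.
under eq_big_seq => l' l'c do rewrite (dual_frames_gram us_bs lc l'c).
rewrite (bigD1_seq l lc (dual_frames_uniqr N_gt0 us_bs)) /= big1 => [|l' l'l]; last first.
  by rewrite eq_sym (negPf l'l) mul0r mulr0.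
by rewrite eqxx mul1r addr0 mulrC.
Qed.

End DiscreteFourier.

(** * Integration against a self-similar measure *)

Section SelfSimilarIntegral.
Local Open Scope ereal_scope.
Variables (K : realType) (mu : probability (measurableTypeR K) K).
Local Notation T := (measurableTypeR K).

Lemma measurable_affine (a b : K) :
  measurable_fun [set: T] (fun x : T => (a + b * x)%R : T).
Proof.
apply: measurable_funD => //; apply: measurable_funM => //.
Qed.

Lemma integral_mixture (ds : seq K) (c : K) (tau : K -> T -> T) (F : T -> \bar K) :
  (0 <= c)%R -> (forall d, measurable_fun [set: T] (tau d)) ->
  (forall E : set T, measurable E ->
     mu E = c%:E * \sum_(d <- ds) mu (tau d @^-1` E)) ->
  measurable_fun [set: T] F -> (forall x, 0 <= F x) ->
  \int[mu]_x F x = c%:E * \sum_(d <- ds) \int[mu]_x F (tau d x).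
Proof.
move=> c0 mtau muE mF F0.
(* [msum] takes a sequence of measures; the default 0 of [nth] is never reached, as only the first
   [size ds] terms are summed. *)
pose m_ (n : nat) : {measure set T -> \bar K} := pushforward mu (tau (nth 0%R ds n)).
transitivity (\int[mscale (NngNum c0) (msum (m_ (fun n => mtau _)) (size ds))]_x F x).
  apply: eq_measure_integral => A mA _.
  by rewrite /mscale /= /msum muE// (big_nth 0%R) big_mkord.
rewrite ge0_integral_mscale//= ge0_integral_measure_sum//.
rewrite (big_nth 0%R) big_mkord; congr (_ * _); apply: eq_bigr => i _.
by rewrite ge0_integral_pushforward.
Qed.

End SelfSimilarIntegral.

(** * Digits and frequencies of each level *)

Section LevelFrames.
Variables (K : realType) (N : nat).
Hypothesis N_gt1 : (1 < N)%N.
Implicit Types (es : seq nat) (c : K).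

Let N_gt0 : (0 < N)%N := ltnW N_gt1.

Let NK_gt0 : 0 < N%:R :> K. Proof. by rewrite ltr0n. Qed.

Let NK_neq0 : N%:R != 0 :> K. Proof. exact: lt0r_neq0. Qed.

(** Here c is a power of M. The exponent e + 1 in [freq_steps] makes the product of matching entries
    equal to 1/N. *)
Definition digit_steps c es : seq K := [seq c^-1 * N%:R ^+ e | e <- es].
Definition freq_steps c es : seq K := [seq c * N%:R ^- e.+1 | e <- es].

(** Inside the block N^e' N^-(e+1) is an integer for e' > e, and sorting [es] puts such pairs on the
    side where integrality is required; the hypothesis covers the steps after the block. *)
Lemma dual_frames_cat c es (us bs : seq K) : c != 0 -> sorted ltn es ->
  (forall a, a \in us -> forall e, e \in es ->
     a * (c * N%:R ^- e.+1) \is a Num.int) ->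
  dual_frames N us bs ->
  dual_frames N (digit_steps c es ++ us) (freq_steps c es ++ bs).
Proof.
move=> c0; elim: es => [//|e es IH] /= ees aint df; split.
- by rewrite mulrACA mulVf// mul1r exprSr invfM mulrA divff ?expf_neq0// mul1r.
- move=> a'; rewrite mem_cat => /orP[/mapP[e' e'es ->]|a'us]; last first.
    by apply: aint; rewrite ?mem_head.
  rewrite mulrACA mulVf// mul1r.
  have ee' : (e < e')%N by move: ees; rewrite (path_sortedE ltn_trans) => /andP[/allP/(_ _ e'es)].
  by rewrite -(subnKC ee') exprD mulrAC divff ?expf_neq0// mul1r -natrX natr_int.
- rewrite -/(digit_steps c es) -/(freq_steps c es).
  apply: IH df; first exact: path_sorted ees.
  by move=> a aus e' e'es; apply: aint; rewrite // inE e'es orbT.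
Qed.

Lemma comb_ge0 (us : seq K) x : (forall a, a \in us -> 0 <= a) ->
  x \in comb N us -> 0 <= x.
Proof.
elim: us x => [|a us IH] x us0; first by rewrite inE => /eqP ->.
move=> /combP[k [x' [_ x'c ->]]]; rewrite addr_ge0 ?mulr_ge0 ?ler0n ?(us0 a (mem_head _ _))//.
by apply: (IH x' _ x'c) => a' a'us; rewrite us0// inE a'us orbT.
Qed.

(** A base N expansion: the digits after place e + 1 add up to less than one unit of that place. *)
Lemma comb_freq_lt es e0 y : sorted ltn es -> (forall e, e \in es -> (e0 <= e)%N) ->
  y \in comb N (freq_steps 1 es) -> y < N%:R ^- e0.
Proof.
elim: es e0 y => [|e es IH] e0 y /=.
  by rewrite inE => _ _ /eqP ->; rewrite invr_gt0 exprn_gt0.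
move=> ees e0e /combP[k [y' [kN y'c ->]]].
have y'lt : y' < N%:R ^- e.+1.
  apply: (IH e.+1 y' (path_sorted ees) _ y'c).
  by move=> e'; move: ees; rewrite (path_sortedE ltn_trans) => /andP[/allP h _] /h.
rewrite mul1r.
apply: (@lt_le_trans _ _ (N%:R ^- e)); last first.
  by rewrite lef_pV2 ?posrE ?exprn_gt0// ler_eXn2l ?ltr1n// e0e ?mem_head.
have -> : N%:R ^- e = N%:R ^- e.+1 * N%:R :> K.
  by rewrite exprSr invfM -mulrA mulVf ?mulr1.
have kN1 : k%:R + 1 <= N%:R :> K by rewrite natr1 ler_nat.
have : 0 < N%:R ^- e.+1 :> K by rewrite invr_gt0 exprn_gt0.
move: y'lt kN1; set u := N%:R ^- e.+1; nra.
Qed.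

(** The bound is the value of the number with digit N - 1 at every place from e0 to q - 1. *)
Lemma comb_digit_le es e0 q x : sorted ltn es -> (e0 <= q)%N ->
  (forall e, e \in es -> (e0 <= e < q)%N) ->
  x \in comb N (digit_steps 1 es) -> x <= N%:R ^+ q - N%:R ^+ e0.
Proof.
elim: es e0 x => [|e es IH] e0 x /=.
  by rewrite inE => _ e0q _ /eqP ->; rewrite subr_ge0 ler_eXn2l ?ltr1n.
move=> ees e0q e0e /combP[k [x' [kN x'c ->]]].
have /andP[e0le eq] := e0e e (mem_head _ _).
have x'le : x' <= N%:R ^+ q - N%:R ^+ e.+1.
  apply: (IH e.+1 x' (path_sorted ees) eq _ x'c) => e'.
  move: (ees); rewrite (path_sortedE ltn_trans) => /andP[/allP h _] e'es.
  by rewrite h//=; have /andP[] := e0e e' (mem_behead (s := e :: es) e'es).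
rewrite invr1 mul1r.
have : N%:R ^+ e0 <= N%:R ^+ e :> K by rewrite ler_eXn2l ?ltr1n.
have kN1 : k%:R + 1 <= N%:R :> K by rewrite natr1 ler_nat.
have : 0 < N%:R ^+ e :> K by rewrite exprn_gt0.
move: x'le kN1; rewrite exprSr; set u := N%:R ^+ e; nra.
Qed.

End LevelFrames.

Section Levels.
Variables (K : realType) (N R q : nat) (es : seq nat).
Hypotheses (N_gt1 : (1 < N)%N) (R_gt1 : (1 < R)%N).
Hypotheses (es_sorted : sorted ltn es) (es_ltq : forall e, e \in es -> (e < q)%N).

Let N_gt0 : (0 < N)%N := ltnW N_gt1.
Let NK_gt0 : 0 < N%:R :> K. Proof. by rewrite ltr0n. Qed.
Let NK_neq0 : N%:R != 0 :> K. Proof. exact: lt0r_neq0. Qed.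

Definition base : K := (R * N ^ q)%N%:R.

Lemma base_gt0 : 0 < base.
Proof. by rewrite ltr0n muln_gt0 (ltnW R_gt1) expn_gt0 N_gt0. Qed.

Lemma base_neq0 : base != 0. Proof. exact: lt0r_neq0 base_gt0. Qed.

Lemma base_gt1 : 1 < base.
Proof. by rewrite ltr1n (leq_trans R_gt1)// leq_pmulr// expn_gt0 N_gt0. Qed.

(* [comb N (lev_us k)] is M^-1 D + ... + M^-k D, and [comb N (lev_bs k)] is
   L + M L + ... + M^(k-1) L. *)
Fixpoint lev_us k : seq K :=
  if k is k'.+1 then digit_steps N (base ^+ k'.+1) es ++ lev_us k' else [::].
Fixpoint lev_bs k : seq K :=
  if k is k'.+1 then freq_steps N (base ^+ k'.+1) es ++ lev_bs k' else [::].

Lemma lev_us_int k a : a \in lev_us k -> a * base ^+ k \is a Num.int.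
Proof.
elim: k => //= k IH; rewrite mem_cat => /orP[/mapP[e ees ->]|/IH h].
  by rewrite mulrAC mulVf ?expf_neq0 ?base_neq0// mul1r -natrX natr_int.
by rewrite exprSr mulrA rpredM ?natr_int.
Qed.

Lemma lev_us_ge0 k a : a \in lev_us k -> 0 <= a.
Proof.
elim: k => //= k IH; rewrite mem_cat => /orP[/mapP[e ees ->]|/IH//].
by rewrite mulr_ge0 ?invr_ge0 ?exprn_ge0 ?ler0n.
Qed.

Lemma base_div_int e : (e < q)%N -> base * N%:R ^- e.+1 \is a Num.int.
Proof.
move=> eq; rewrite /base natrM natrX -{1}(subnKC eq) exprD -mulrA [X in _ * X]mulrAC.
by rewrite divff ?expf_neq0// mul1r rpredM ?natr_int// -natrX natr_int.
Qed.

Lemma dual_frames_lev k : dual_frames N (lev_us k) (lev_bs k).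
Proof.
elim: k => //= k IH; apply: dual_frames_cat => //.
  by rewrite expf_neq0 ?base_neq0.
move=> a aus e ees; rewrite exprSr -!mulrA mulrA rpredM ?lev_us_int//.
by rewrite base_div_int// es_ltq.
Qed.

(** Puts the points of level k at left ends of M-adic cells, where cellwise functions get
    sampled. *)
Lemma comb_lev_us_nat k x : x \in comb N (lev_us k) ->
  exists n : nat, x = n%:R / base ^+ k.
Proof.
move=> xc; have Mk0 : 0 < base ^+ k by rewrite exprn_gt0 ?base_gt0.
have : x * base ^+ k \is a Num.nat.
  rewrite natrEint (comb_int _ xc) ?mulr_ge0 ?(ltW Mk0)//; last exact: lev_us_int.
  by apply: comb_ge0 xc => a; exact: lev_us_ge0.
by case/natrP => n e; exists n; rewrite -e mulfK ?gt_eqF.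
Qed.

Lemma freq_stepsE (c : K) : freq_steps N c es = [seq c * b | b <- freq_steps N 1 es].
Proof. by rewrite -map_comp; apply: eq_map => e /=; rewrite mul1r. Qed.

Lemma digit_stepsE (c : K) : digit_steps N c es = [seq c^-1 * b | b <- digit_steps N 1 es].
Proof. by rewrite -map_comp; apply: eq_map => e /=; rewrite invr1 mul1r. Qed.

(** An expansion in base M: the leading digit is an integer below M since z < 1, and the rest is
    below M^k. Integrality makes the spectrum discrete; the bound on l keeps the phase l M^-k y
    within y turns. *)
Lemma comb_lev_bs_nat k l : l \in comb N (lev_bs k) ->
  exists2 n : nat, l = n%:R & l < base ^+ k.
Proof.
elim: k l => [|k IH] l /=.
  by rewrite inE => /eqP ->; exists 0%N; rewrite ?expr0.
move=> /comb_catP[y [l' [+ /IH[n en nlt] ->]]].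
rewrite freq_stepsE comb_mul => /mapP[z zc ->].
have zlt : z < 1 by rewrite -[1]invr1 -(expr0 N%:R); apply: (comb_freq_lt N_gt1) zc.
have z0 : 0 <= z.
  apply: comb_ge0 zc => a /mapP[e _ ->].
  by rewrite mul1r invr_ge0 exprn_ge0.
have : base * z \is a Num.nat.
  rewrite natrEint mulr_ge0 ?(ltW base_gt0)// andbT mulrC.
  apply: comb_int zc => a /mapP[e ees ->].
  by rewrite mul1r mulrC base_div_int ?es_ltq.
case/natrP => m em; exists (R * N ^ q * 0 + (R * N ^ q) ^ k * m + n)%N.
  by rewrite muln0 add0n natrD natrM natrX -/base -em -en exprSr mulrA.
have mlt : m%:R + 1 <= base.
  by rewrite natr1 ler_nat -(ltr_nat K) -em -/base gtr_pMr ?base_gt0.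
rewrite exprSr -mulrA em; have : 0 < base ^+ k by rewrite exprn_gt0 ?base_gt0.
move: nlt mlt; set B := base ^+ k; nra.
Qed.

End Levels.

Lemma big_comb_cat (K : realType) (N : nat) (R : Type) (idx : R) (op : Monoid.law idx)
    (us vs : seq K) (F : K -> R) :
  \big[op/idx]_(x <- comb N (us ++ vs)) F x =
  \big[op/idx]_(x <- comb N us) \big[op/idx]_(y <- comb N vs) F (x + y).
Proof.
elim: us F => [|a us IH] F /=.
  by rewrite big_seq1; apply: eq_bigr => y _; rewrite add0r.
rewrite -/(comb N (a :: (us ++ vs))) -/(comb N (a :: us)) !big_comb.
apply: eq_bigr => k _; rewrite IH; apply: eq_bigr => x _; apply: eq_bigr => y _.
by rewrite addrA.
Qed.

(** * Level-k averages and the interval that carries the measure *)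

Section LevelIntegral.
Local Open Scope ereal_scope.
Variables (K : realType) (N R q : nat) (es : seq nat).
Hypotheses (N_gt1 : (1 < N)%N) (R_gt1 : (1 < R)%N).
Hypotheses (es_sorted : sorted ltn es) (es_ltq : forall e, e \in es -> (e < q)%N).
Variable mu : probability (measurableTypeR K) K.
Local Notation T := (measurableTypeR K).
Local Notation M := (base K N R q).
Local Notation digit_combs := (comb N (digit_steps N (1%R : K) es)).
Local Notation us := (lev_us K N R q es).

Hypothesis muE : forall E : set T, measurable E ->
  mu E = ((N ^ size es)%:R^-1)%:E *
         \sum_(d <- digit_combs) mu ((fun x : T => (M^-1 * (x + d))%R : T) @^-1` E).

Let N_gt0 : (0 < N)%N := ltnW N_gt1.
Let M_gt0 : (0 < M)%R := base_gt0 K q N_gt1 R_gt1.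

(** Self-similarity is applied inside each copy, so the new digits are scaled by M^-(k+1); this is
    the block that [lev_us] puts in front, whence the exchange of sums. *)
Lemma integral_level k (F : T -> \bar K) :
  measurable_fun [set: T] F -> (forall x, 0 <= F x) ->
  \int[mu]_x F x = ((N ^ size (us k))%:R^-1)%:E *
    \sum_(x <- comb N (us k)) \int[mu]_y F (x + (M ^+ k)^-1 * y)%R.
Proof.
move=> mF F0; elim: k => [|k ->].
  rewrite /= expn0 big_seq1 expr0 invr1 mul1e; apply: eq_integral => y _.
  by rewrite add0r mul1r.
under eq_bigr => x _.
  rewrite (integral_mixture (c := ((N ^ size es)%:R^-1)) (ds := digit_combs)
    (tau := fun d y => (M^-1 * (y + d))%R) _ _ muE)//; last first.
  - apply: (measurableT_comp mF); exact: measurable_affine.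
  - move=> d; have -> : (fun y => (M^-1 * (y + d))%R : T) =
        (fun y : T => (M^-1 * d + M^-1 * y)%R : T).
      by apply/funext => y; rewrite mulrDr addrC.
    exact: measurable_affine.
  over.
rewrite /= -ge0_sume_distrr; last first.
  by move=> x _; apply: sume_ge0 => d _; exact: integral_ge0.
rewrite muleA -EFinM -invfM -natrM -expnD size_cat size_map addnC; congr (_ * _).
rewrite exchange_big big_comb_cat (digit_stepsE _ _ (M ^+ k.+1)) comb_mul big_map.
apply: eq_bigr => d _; apply: eq_bigr => x _; apply: eq_integral => y _.
by congr F; rewrite exprS invfM; ring.
Qed.

(* The attractor of the maps (x + d) / M, d in D, lies in [0, hull_bound], since
   max D <= N^q - 1. *)
Definition hull_bound : K := (((N ^ q)%:R - 1) / (M - 1))%R.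

Let g := hull_bound.

Lemma hull_bound_ge0 : (0 <= g)%R.
Proof.
by rewrite divr_ge0// subr_ge0 ?(ltW (base_gt1 K q N_gt1 R_gt1))// ler1n expn_gt0 N_gt0.
Qed.

(** With u = N^q this reads 2 (u - 1) < R u - 1, true once R >= 2. *)
Lemma hull_bound_lt : (g < 2^-1)%R.
Proof.
rewrite /g /hull_bound ltr_pdivrMr ?subr_gt0 ?base_gt1//.
rewrite ltr_pdivlMl// /base natrM.
have : (2 <= R%:R :> K)%R by rewrite ler_nat.
have : (1 <= (N ^ q)%:R :> K)%R by rewrite ler1n expn_gt0 N_gt0.
set u := (N ^ q)%:R; nra.
Qed.

Let off (eps : K) : set T := [set x : T | (x < - eps)%R] `|` [set x : T | (g + eps < x)%R].

Let measurable_off eps : measurable (off eps).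
Proof.
have -> : off eps = `]-oo, (- eps)%R[%classic `|` `](g + eps)%R, +oo[%classic.
  by apply/seteqP; split=> x; rewrite /off /= !in_itv/= ?andbT.
by apply: measurableU; exact: measurable_itv.
Qed.

Let off_sub e1 e2 : (e1 <= e2)%R -> off e2 `<=` off e1.
Proof. by move=> e12 x [|] /= h; [left|right]; rewrite /=; lra. Qed.

(** Each map sends [0, g] into itself, by d <= (M - 1) g, and divides distances by M; a point whose
    image is eps away from [0, g] was itself M eps away. *)
Lemma off_expand eps : (0 <= eps)%R -> mu (off eps) <= mu (off (M * eps)%R).
Proof.
move=> e0; rewrite muE//.
have le d : d \in digit_combs ->
    mu ((fun x : T => (M^-1 * (x + d))%R : T) @^-1` (off eps)) <= mu (off (M * eps)%R).
  move=> dc.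
  have d0 : (0 <= d)%R.
    by apply: comb_ge0 dc => a /mapP[e _ ->]; rewrite invr1 mul1r exprn_ge0.
  have dq : (d <= (M - 1) * g)%R.
    rewrite /g /hull_bound mulrC divfK; last by rewrite subr_eq0 gt_eqF ?base_gt1.
    rewrite natrX -(expr0 N%:R); exact: (comb_digit_le N_gt1) dc.
  apply: le_measure; rewrite ?inE//.
    rewrite -[X in measurable X]setTI.
    have -> : (fun x => (M^-1 * (x + d))%R : T) =
        (fun y : T => (M^-1 * d + M^-1 * y)%R : T).
      by apply/funext => y; rewrite mulrDr addrC.
    exact: measurable_affine.
  move=> x [|] /= h; [left|right] => /=.
    by move: h; rewrite mulrC ltr_pdivrMr//; lra.
  by move: h; rewrite mulrC ltr_pdivlMr//; lra.
apply: (@le_trans _ _ (((N ^ size es)%:R^-1)%:E *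
    \sum_(d <- digit_combs) mu (off (M * eps)%R))).
  apply: lee_wpmul2l; first by rewrite lee_fin invr_ge0.
  by rewrite big_seq [leRHS]big_seq; apply: lee_sum => d; exact: le.
rewrite big_const_seq count_predT size_comb size_map.
rewrite (_ : iter _ _ _ = (N ^ size es)%:R%:E * mu (off (M * eps)%R)).
  by rewrite muleA -EFinM mulVf ?mul1e// pnatr_eq0 expn_eq0 gtn_eqF.
elim: (N ^ size es)%N => [|n IH]; first by rewrite mul0e.
by rewrite iterS IH -natr1 EFinD ge0_muleDl// mul1e addeC.
Qed.

(** Iterating [off_expand] drives the set to infinity, where the sets [off n] decrease to the empty
    set and a finite measure tends to 0. *)
Lemma off_null eps : (0 < eps)%R -> mu (off eps) = 0.
Proof.
move=> e0; apply/eqP; rewrite eq_le measure_ge0 andbT.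
have le k : mu (off eps) <= mu (off (M ^+ k * eps)%R).
  elim: k => [|k IH]; first by rewrite mul1r.
  rewrite exprS -mulrA (le_trans IH)// off_expand//.
  by rewrite mulr_ge0 ?exprn_ge0 ?ltW.
have cvg0 : mu (off n%:R) @[n --> \oo] --> 0.
  have -> : 0 = mu (\bigcap_n off n%:R).
    rewrite (_ : \bigcap_n _ = set0) ?measure0//.
    apply/seteqP; split=> // x h.
    have [n] : exists n : nat, (`|x| < n%:R)%R.
      by exists (Num.bound `|x|%R); rewrite archi_boundP.
    have := h n I; have := hull_bound_ge0.
    by rewrite ltr_norml -/g => g0 [|] /= h1 /andP[h2 h3]; lra.
  apply: nonincreasing_cvg_mu => //.
  - by rewrite (le_lt_trans (probability_le1 _ _)) ?ltry.
  - exact: bigcapT_measurable.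
  - by move=> n m nm; apply/subsetPset; apply: off_sub; rewrite ler_nat.
have len (n : nat) : mu (off eps) <= mu (off n%:R).
  (* M^k eps exceeds n once k >= n / eps, because M^k > k. *)
  pose k := Num.bound (n%:R / eps)%R.
  apply: (le_trans (le k)); apply: le_measure; rewrite ?inE//.
  apply: off_sub; rewrite -ler_pdivrMr//.
  apply: (@le_trans _ _ k%:R%R).
    by rewrite ltW// archi_boundP// divr_ge0// ltW.
  rewrite /base -natrX ler_nat ltnW// ltn_expl//.
  by rewrite -(ltr_nat K) base_gt1.
rewrite -(cvg_lim _ cvg0)//; apply: lime_ge; first by apply/cvg_ex; exists 0.
by apply: nearW.
Qed.

Lemma ae_hull : {ae mu, forall y : T, (0 <= y <= g)%R}.
Proof.
exists (\bigcup_n off n.+1%:R^-1); split.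
- exact: bigcupT_measurable.
- apply/eqP; rewrite -measure_le0; apply: le_trans (measure_sigma_subadditive _ _ _ (@subset_refl _ _)) _ => //.
    exact: bigcupT_measurable.
  by rewrite eseries0// => n _ _; apply: off_null; rewrite invr_gt0.
- move=> y /= /negP; rewrite negb_and -!ltNge => /orP[h|h].
    have [n hn] := ltr_add_invr h.
    by exists n => //; rewrite /off /=; left; move: hn; set w := (_^-1)%R; lra.
  have [n hn] := ltr_add_invr h.
  by exists n => //; rewrite /off /=; right; move: hn; set w := (_^-1)%R; lra.
Qed.

Lemma measure_outside_hull (U : set T) : measurable U ->
  (forall y, U y -> ~~ (0 <= y <= g)%R) -> mu U = 0.
Proof.
move=> mU h; have [A [mA A0 sub]] := ae_hull.
apply: (subset_measure0 mU mA _ A0).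
by move=> y Uy; apply: sub => /=; apply/negP; exact: h.
Qed.

End LevelIntegral.

(** * Complex measurable functions and square integrals *)

Section ComplexMeasurable.
Context {d : measure_display} {T : measurableType d} {K : realType}.
Implicit Types (f g h : T -> K[i]).

(** Coordinatewise, to match the two measurability clauses of [inL2]. *)
Definition cmeas f := measurable_fun [set: T] (fun x => complex.Re (f x)) /\
  measurable_fun [set: T] (fun x => complex.Im (f x)).

Lemma cmeasD f g : cmeas f -> cmeas g -> cmeas (fun x => f x + g x)%R.
Proof.
move=> [f1 f2] [g1 g2]; split.
- have -> : (fun x => complex.Re (f x + g x)) =
      ((fun x => complex.Re (f x)) \+ (fun x => complex.Re (g x)))%R.
    by apply/funext => x; rewrite /=; case: (f x) => a b; case: (g x).
  exact: measurable_funD.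
- have -> : (fun x => complex.Im (f x + g x)) =
      ((fun x => complex.Im (f x)) \+ (fun x => complex.Im (g x)))%R.
    by apply/funext => x; rewrite /=; case: (f x) => a b; case: (g x).
  exact: measurable_funD.
Qed.

Lemma cmeasM f g : cmeas f -> cmeas g -> cmeas (fun x => f x * g x)%R.
Proof.
move=> [f1 f2] [g1 g2]; split.
- have -> : (fun x => complex.Re (f x * g x)) =
      ((fun x => complex.Re (f x)) \* (fun x => complex.Re (g x)) \-
       (fun x => complex.Im (f x)) \* (fun x => complex.Im (g x)))%R.
    by apply/funext => x; rewrite /=; case: (f x) => a b; case: (g x).
  by apply: measurable_funB; exact: measurable_funM.
- have -> : (fun x => complex.Im (f x * g x)) =
      ((fun x => complex.Re (f x)) \* (fun x => complex.Im (g x)) \+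
       (fun x => complex.Im (f x)) \* (fun x => complex.Re (g x)))%R.
    by apply/funext => x; rewrite /=; case: (f x) => a b; case: (g x).
  by apply: measurable_funD; exact: measurable_funM.
Qed.

Lemma cmeas_cst (c : K[i]) : cmeas (fun=> c).
Proof. by split; exact: measurable_cst. Qed.

Lemma cmeasB f g : cmeas f -> cmeas g -> cmeas (fun x => f x - g x)%R.
Proof.
move=> mf mg; have -> : (fun x => f x - g x)%R = (fun x => f x + (-1) * g x)%R.
  by apply/funext => x; rewrite mulN1r.
by apply: cmeasD => //; apply: cmeasM => //; exact: cmeas_cst.
Qed.

Lemma cmeas_sum (I : Type) (r : seq I) (F : I -> T -> K[i]) :
  (forall i, cmeas (F i)) -> cmeas (fun x => \sum_(i <- r) F i x)%R.
Proof.
move=> mF; elim: r => [|i r IH].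
  by under eq_fun do rewrite big_nil; exact: cmeas_cst.
by under eq_fun do rewrite big_cons; exact: cmeasD.
Qed.

Lemma cmeas_real (u : T -> K) : measurable_fun [set: T] u -> cmeas (fun x => (u x)%:C%C).
Proof. by move=> mu'; split => //=; exact: measurable_cst. Qed.

Lemma measurable_sqmod f : cmeas f ->
  measurable_fun [set: T] (fun x => (sqmod (f x))%:E).
Proof.
by move=> [f1 f2]; apply/measurable_EFinP; apply: measurable_funD;
  exact: measurable_funX.
Qed.

End ComplexMeasurable.

Section SquareIntegral.
Local Open Scope ereal_scope.
Context {d : measure_display} {T : measurableType d} {K : realType}.
Variable mu : {measure set T -> \bar K}.
Implicit Types (f g h : T -> K[i]).

Definition sqint f : \bar K := \int[mu]_x (sqmod (f x))%:E.

Lemma sqint_ge0 f : 0 <= sqint f.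
Proof. by apply: integral_ge0 => x _; rewrite lee_fin sqmod_ge0. Qed.

Lemma sqintZ (c : K[i]) f : cmeas f -> sqint (fun x => c * f x)%R = (sqmod c)%:E * sqint f.
Proof.
move=> mf; rewrite /sqint -ge0_integralZl_EFin ?sqmod_ge0//.
- by apply: eq_integral => x _; rewrite sqmodM EFinM.
- by move=> x _; rewrite lee_fin sqmod_ge0.
- exact: measurable_sqmod.
Qed.

Lemma sqintD_le (e : K) f g : (0 < e)%R -> cmeas f -> cmeas g ->
  sqint (fun x => f x + g x)%R <= (1 + e)%:E * sqint f + (1 + e^-1)%:E * sqint g.
Proof.
move=> e0 mf mg; have e1 : (0 <= 1 + e)%R by rewrite addr_ge0// ltW.
have e2 : (0 <= 1 + e^-1)%R by rewrite addr_ge0// invr_ge0 ltW.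
have nn (c : K) u x : (0 <= c)%R -> 0 <= c%:E * (sqmod (u x : K[i]))%:E.
  by move=> c0; rewrite mule_ge0// lee_fin sqmod_ge0.
rewrite /sqint -!ge0_integralZl_EFin//; try exact: measurable_sqmod;
  try by move=> x _; rewrite lee_fin sqmod_ge0.
have mz (c : K) u : cmeas u -> measurable_fun [set: T] (fun x => c%:E * (sqmod (u x))%:E).
  by move=> mu'; apply: measurable_funeM; exact: measurable_sqmod.
rewrite -ge0_integralD//; try (by move=> x _; exact: nn); try exact: mz.
apply: ge0_le_integral => //.
- by move=> x _; rewrite lee_fin sqmod_ge0.
- by apply: measurable_sqmod; exact: cmeasD.
- by apply: emeasurable_funD; exact: mz.
- by move=> x _; rewrite -!EFinM -EFinD lee_fin sqmodD_le.
Qed.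

(** With weight 1 both terms are doubled, hence the quarters. *)
Lemma sqintD_lt f g (e : K) : cmeas f -> cmeas g -> sqint f < (e / 4)%:E ->
  sqint g < (e / 4)%:E -> sqint (fun x => f x + g x)%R < e%:E.
Proof.
move=> mf mg hf hg; apply: le_lt_trans (sqintD_le ltr01 mf mg) _.
have -> : e%:E = (1 + 1)%:E * (e / 4)%:E + (1 + 1^-1)%:E * (e / 4)%:E.
  by rewrite -!EFinM -EFinD invr1; congr EFin; field.
by rewrite lteD// lte_pmul2l.
Qed.

Lemma sqintC f g : sqint (fun x => f x - g x)%R = sqint (fun x => g x - f x)%R.
Proof.
apply: eq_integral => x _; congr EFin.
by case: (f x) (g x) => a b [c e]; rewrite /sqmod /=; ring.
Qed.

End SquareIntegral.

(** * Density of cellwise functions among square integrable ones *)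

Section CellDensity.
Variables (K : realType) (m : nat) (mu : probability (measurableTypeR K) K).
Hypothesis m_gt1 : (1 < m)%N.
Local Notation T := (measurableTypeR K).
Implicit Types (f g : T -> K[i]) (A B : set T).

Let m_gt0 : 0 < m%:R :> K. Proof. by rewrite ltr0n ltnW. Qed.

(* constant on the m-adic cells [n / m^k, (n + 1) / m^k[, with n a natural number *)
Definition cellwise (rT : Type) (k : nat) (g : K -> rT) := forall (n : nat) x y,
  0 <= x < 1 -> 0 <= y < 1 -> g ((n%:R + x) / m%:R ^+ k) = g ((n%:R + y) / m%:R ^+ k).

Lemma cellwiseS (rT : Type) k (g : K -> rT) : cellwise k g -> cellwise k.+1 g.
Proof.
move=> cg n x y.
(* Cell n of level k + 1 is the part number n mod m of the cell n / m of level k. *)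
have step z : 0 <= z < 1 -> exists2 z', 0 <= z' < 1 &
    (n%:R + z) / m%:R ^+ k.+1 = ((n %/ m)%:R + z') / m%:R ^+ k :> K.
  move=> /andP[z0 z1]; exists (((n %% m)%:R + z) / m%:R).
    rewrite divr_ge0 ?addr_ge0//=.
    rewrite ltr_pdivrMr// mul1r.
    have : (n %% m)%:R + 1 <= m%:R :> K by rewrite natr1 ler_nat ltn_mod ltnW.
    lra.
  rewrite {1}(divn_eq n m) natrD natrM exprSr; field.
  by rewrite expf_neq0 gt_eqF.
move=> /step[x' hx ->] /step[y' hy ->]; exact: cg.
Qed.

Lemma cellwise_le (rT : Type) k k' (g : K -> rT) :
  (k <= k')%N -> cellwise k g -> cellwise k' g.
Proof.
move=> /subnKC <-; elim: (k' - k)%N => [|j IH]; first by rewrite addn0.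
by move=> /IH h; rewrite addnS; exact: cellwiseS.
Qed.

Definition cell_approx f := forall eps : K, 0 < eps -> exists k g,
  [/\ cmeas g, cellwise k g & (sqint mu (fun x => f x - g x)%R < eps%:E)%E].

Lemma cell_approx_lim f : cmeas f -> (forall eps : K, 0 < eps ->
    exists2 g, cmeas g /\ cell_approx g & (sqint mu (fun x => f x - g x)%R < eps%:E)%E) ->
  cell_approx f.
Proof.
move=> mf h eps e0; have e4 : 0 < eps / 4 by rewrite divr_gt0.
have [g [mg ag] fg] := h _ e4; have [k [u [mu' cu gu]]] := ag _ e4.
exists k, u; split=> //.
rewrite (_ : (fun x => f x - u x) = (fun x => (f x - g x) + (g x - u x))).
  by apply: sqintD_lt => //; exact: cmeasB.
by apply/funext => x; rewrite addrA subrK.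
Qed.

Lemma cell_approxD f g : cmeas f -> cmeas g -> cell_approx f -> cell_approx g ->
  cell_approx (fun x => f x + g x).
Proof.
move=> mf mg af ag eps e0; have e4 : 0 < eps / 4 by rewrite divr_gt0.
have [k [u [mu' cu fu]]] := af _ e4; have [l [v [mv cv gv]]] := ag _ e4.
exists (maxn k l), (fun x => u x + v x); split.
- exact: cmeasD.
- move=> n x y hx hy.
  by rewrite (cellwise_le (leq_maxl k l) cu _ hx hy) (cellwise_le (leq_maxr k l) cv _ hx hy).
rewrite (_ : (fun x => f x + g x - (u x + v x)) =
             (fun x => (f x - u x) + (g x - v x))).
  by apply: sqintD_lt => //; exact: cmeasB.
by apply/funext => x; rewrite opprD addrACA.
Qed.

Lemma cell_approxZ c f : cmeas f -> cell_approx f -> cell_approx (fun x => c * f x).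
Proof.
move=> mf af eps e0; have c1 : 0 < sqmod c + 1 by rewrite ltr_wpDl ?sqmod_ge0.
have [k [u [mu' cu fu]]] := af (eps / (sqmod c + 1)) (divr_gt0 e0 c1).
exists k, (fun x => c * u x); split.
- by apply: cmeasM => //; exact: cmeas_cst.
- by move=> n x y hx hy; rewrite (cu n x y).
under eq_fun do rewrite -mulrBr.
rewrite sqintZ; last exact: cmeasB.
have h0 := sqint_ge0 mu (fun x => f x - u x).
have fin : sqint mu (fun x => f x - u x)%R \is a fin_num.
  by rewrite ge0_fin_numE// (lt_trans fu)// ltry.
move: fu h0; rewrite -(fineK fin) -EFinM !lte_fin lee_fin.
rewrite ltr_pdivlMr//; move: (sqmod_ge0 c); set z := fine _; nra.
Qed.

Let ind A : T -> K[i] := fun x => (\1_A x)%:C%C.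

Let cmeas_ind A : measurable A -> cmeas (ind A).
Proof. by move=> mA; apply: cmeas_real; exact: measurable_indic. Qed.

Lemma sqint_indic A : measurable A -> sqint mu (ind A) = mu A.
Proof.
move=> mA; rewrite -(setIT A) -integral_indic//; apply: eq_integral => x _.
by congr EFin; rewrite /sqmod /ind setIT /= expr0n addr0 indicE; case: (x \in A); rewrite ?expr1n ?expr0n.
Qed.

(** Dynkin's pi-lambda argument: G is a pi-system of sets that are cellwise at some level, H the
    lambda-system of sets whose indicator can be approximated, and G generates the Borel sets. *)
Lemma cell_approx_indic A : measurable A -> cell_approx (ind A).
Proof.
move: A; pose G := [set A | measurable A /\ exists k, cellwise k (fun x : K => x \in A)].
pose H := [set A | measurable A /\ cell_approx (ind A)].
have indD A B : A `<=` B -> ind (B `\` A) = (fun x => ind B x + (-1) * ind A x).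
  move=> AB; apply/funext => x; rewrite /ind !indicE in_setD mulN1r.
  have [xA|xA] := boolP (x \in A).
    by rewrite mem_set ?subrr//; apply: AB; rewrite -inE.
  by rewrite andbT subr0.
have lam : lambda_system setT H.
  split=> //.
  - split=> // eps e0; exists 0%N, (ind setT); split; first exact: cmeas_ind.
      by move=> n x y _ _; rewrite /ind !indicE !in_setT.
    under eq_fun do rewrite subrr.
    rewrite /sqint /sqmod/= integral0_eq ?lte_fin// => x _.
    by rewrite expr0n addr0.
  - move=> A B AB [mA hA] [mB hB]; split; first exact: measurableD.
    rewrite indD//; apply: cell_approxD => //; first exact: cmeas_ind.
      by apply: cmeasM; [exact: cmeas_cst|exact: cmeas_ind].
    by apply: cell_approxZ => //; exact: cmeas_ind.
  - move=> F ndF HF.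
    have mF n : measurable (F n) by have [] := HF n.
    have mU : measurable (\bigcup_n F n) by exact: bigcupT_measurable.
    split=> //; apply: cell_approx_lim; first exact: cmeas_ind.
    move=> eps e0.
    (* The squared distance between the indicators of the union and of F n is the measure of what F
       n misses, which tends to 0 by continuity from above. *)
    have cvg0 : (mu (\bigcup_n F n `\` F n) @[n --> \oo] --> 0)%E.
      have -> : (0 = mu (\bigcap_k (\bigcup_n F n `\` F k)))%E.
        rewrite (_ : \bigcap_k _ = set0) ?measure0//.
        by apply/seteqP; split=> // x h; have [[n _ Fn] _] := h 0%N I; have [] := h n I.
      apply: nonincreasing_cvg_mu => //.
      - by rewrite (le_lt_trans (probability_le1 _ _)) ?ltry//; exact: measurableD.
      - by move=> n; exact: measurableD.
      - by apply: bigcapT_measurable => n; exact: measurableD.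
      - move=> n p np; apply/subsetPset => x [xU xF]; split=> // Fn; apply: xF.
        by move/subsetPset : (ndF _ _ np); apply.
    have [n _ /(_ n (leqnn n)) hn] : \forall n \near \oo, (mu (\bigcup_n F n `\` F n) < eps%:E)%E.
      by apply: (cvg0 [set y | (y < eps%:E)%E]); apply: open_ereal_lt'; rewrite lte_fin.
    exists (ind (F n)); first by split; [exact: cmeas_ind|have [] := HF n].
    rewrite (_ : (fun _ => _) = ind (\bigcup_n F n `\` F n)).
      by rewrite sqint_indic//; exact: measurableD.
    rewrite indD; first by apply/funext => x; rewrite mulN1r.
    exact: bigcup_sup.
have GI : setI_closed G.
  move=> A B [mA [k cA]] [mB [l cB]]; split; first exact: measurableI.
  exists (maxn k l) => n x y hx hy; rewrite !in_setI.
  by rewrite (cellwise_le (leq_maxl k l) cA _ hx hy) (cellwise_le (leq_maxr k l) cB _ hx hy).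
have GH : G `<=` H.
  move=> A [mA [k cA]]; split=> // eps e0; exists k, (ind A); split.
  - exact: cmeas_ind.
  - by move=> n x y hx hy; rewrite /ind !indicE (cA n x y).
  - under eq_fun do rewrite subrr.
    rewrite /sqint /sqmod/= integral0_eq ?lte_fin// => x _.
    by rewrite expr0n addr0.
have sGH := lambda_system_subset GI lam GH (fun _ _ => @subsetT _ _).
suff sub : (@measurable _ T : set (set T)) `<=` <<s G >> by move=> A /sub/sGH[].
have -> : (@measurable _ T : set (set T)) = (@RGenOInfty.G K).-sigma.-measurable.
  exact: RGenOInfty.measurableE.
apply: smallest_sub; first exact: smallest_sigma_algebra.
move=> _ [a ->].
(* z k / m^k is the first grid point of level k strictly to the right of a. It lies at or before x >
   a as soon as m^k (x - a) >= 1. *)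
pose z k : int := Num.floor (m%:R ^+ k * a) + 1.
have -> : `]a, +oo[%classic = \bigcup_k `[(z k)%:~R / m%:R ^+ k, +oo[%classic.
  apply/seteqP; split=> x; rewrite /= in_itv/= andbT; [move=> ax|move=> [k _]]; last first.
    rewrite /= in_itv/= andbT; apply: lt_le_trans.
    by rewrite ltr_pdivlMr ?exprn_gt0// mulrC floorD1_gt.
  pose k := Num.bound (x - a)^-1; exists k => //=; rewrite in_itv/= andbT.
  have Mk0 : 0 < m%:R ^+ k :> K by rewrite exprn_gt0.
  have xa0 : 0 < x - a by rewrite subr_gt0.
  have : 1 <= m%:R ^+ k * (x - a).
    rewrite -ler_pdivrMr// mul1r; apply: (@le_trans _ _ k%:R).
      by rewrite ltW// archi_boundP// invr_ge0 ltW.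
    by rewrite -natrX ler_nat ltnW// ltn_expl.
  rewrite ler_pdivrMr// /z intrD /= => h.
  have := floor_le (m%:R ^+ k * a); move: h; rewrite mulrBr [x * _]mulrC; lra.
apply: sigma_algebra_bigcup => k; apply: sub_sigma_algebra; split.
  exact: measurable_itv.
exists k => n x y hx hy; rewrite !mem_setE !in_itv/= !andbT.
have Mk0 : 0 < m%:R ^+ k :> K by rewrite exprn_gt0.
(* A ray that starts at a grid point contains a cell or misses it, as n alone decides. *)
have aux t : 0 <= t < 1 -> ((z k)%:~R / m%:R ^+ k <= (n%:R + t) / m%:R ^+ k :> K)
   = (z k <= n%:Z).
  move=> /andP[t0 t1]; rewrite ler_pM2r ?invr_gt0// -(ler_int K) -pmulrn.
  apply/idP/idP => [|h]; last by rewrite (le_trans h)// lerDl.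
  move=> h; rewrite pmulrn ler_int -ltzD1 -(ltr_int K) intrD /=.
  by rewrite (le_lt_trans h)// ltrD2l.
by rewrite !aux.
Qed.

Import HBNNSimple.

Lemma cell_approx_nnsfun (h : {nnsfun T >-> K}) : cell_approx (fun x => (h x)%:C%C).
Proof.
have mh y : measurable (h @^-1` [set y]) by exact: measurable_sfunP.
rewrite (_ : (fun _ => _) = fun x => \sum_(y <- fset_set (range h)) y%:C%C * ind (h @^-1` [set y]) x).
  elim: (fset_set _ : seq K) => [|y r IH].
    under eq_fun do rewrite big_nil.
    move=> eps e0; exists 0%N, (fun=> 0); split; first exact: cmeas_cst.
      by move=> n x y _ _.
    under eq_fun do rewrite subrr.
    rewrite /sqint /sqmod/= integral0_eq ?lte_fin// => x _.
    by rewrite expr0n addr0.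
  under eq_fun do rewrite big_cons.
  have mi z : cmeas (fun x => z%:C%C * ind (h @^-1` [set z]) x).
    by apply: cmeasM; [exact: cmeas_cst|exact: cmeas_ind].
  apply: cell_approxD => //; first by apply: cmeas_sum => z; exact: mi.
  by apply: cell_approxZ; [exact: cmeas_ind|exact: cell_approx_indic].
apply/funext => x; rewrite fimfunE fsbig_finite//= rmorph_sum /=.
by apply: eq_bigr => y _; rewrite rmorphM.
Qed.

(** Simple functions h increase to u; since 0 <= h <= u, the squared error is dominated by u^2 and
    dominated convergence applies. *)
Lemma cell_approx_nonneg (u : T -> K) : measurable_fun setT u -> (forall x, 0 <= u x) ->
  (sqint mu (fun x => (u x)%:C%C) < +oo)%E -> cell_approx (fun x => (u x)%:C%C).
Proof.
move=> mU u0 fin.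
have mu' : measurable_fun [set: T] (EFin \o u) by apply/measurable_EFinP.
pose h := nnsfun_approx measurableT mu'.
have cvgh x : h n x @[n --> \oo] --> u x.
  have /fine_cvgP[_] : (EFin \o (fun n => h n x)) n @[n --> \oo] --> (u x)%:E.
    by apply: cvg_nnsfun_approx => // y _; rewrite lee_fin.
  exact.
have leh n x : h n x <= u x.
  have := cvgh x; move/cvg_lim => <- //; apply: nondecreasing_cvgn_le.
    by move=> a b ab; move: (nd_nnsfun_approx measurableT mu' ab) => /asboolP /(_ x).
  by apply/cvg_ex; exists (u x).
apply: cell_approx_lim; first exact: cmeas_real.
move=> eps e0.
have muh n : cmeas (fun x => (h n x)%:C%C).
  by apply: cmeas_real; exact: measurable_funP.
have sqE n x : sqmod ((u x)%:C%C - (h n x)%:C%C) = (u x - h n x) ^+ 2.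
  by rewrite /sqmod /= subrr expr0n addr0.
have m1 n : measurable_fun [set: T] (fun x => (sqmod ((u x)%:C%C - (h n x)%:C%C))%:E).
  by apply: measurable_sqmod; apply: cmeasB => //; exact: cmeas_real.
have m2 : measurable_fun [set: T] (fun x => (sqmod (u x)%:C%C)%:E).
  by apply: measurable_sqmod; exact: cmeas_real.
have cv : \forall x \ae mu, [set: T] x ->
    (sqmod ((u x)%:C%C - (h n x)%:C%C))%:E @[n --> \oo] --> cst 0%E x.
  apply: aeW => x _; apply: cvg_EFin; first exact: nearW.
  under eq_fun do rewrite /= sqE.
  have -> : 0 = (u x - u x) ^+ 2 :> K by rewrite subrr expr0n.
  by rewrite expr2; under eq_fun do rewrite expr2;
    apply: cvgM; apply: cvgB => //; exact: cvg_cst.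
have ig : mu.-integrable [set: T] (fun x => (sqmod (u x)%:C%C)%:E).
  apply/integrableP; split=> //; apply: le_lt_trans fin.
  apply: ge0_le_integral => //; first exact: measurableT_comp.
  by move=> x _; rewrite /= ger0_norm ?sqmod_ge0.
have bd : \forall x \ae mu, forall n, [set: T] x ->
    (`|(sqmod ((u x)%:C%C - (h n x)%:C%C))%:E| <= (sqmod (u x)%:C%C)%:E)%E.
  apply: aeW => x n _; rewrite /= ger0_norm ?sqmod_ge0// lee_fin sqE /sqmod /=.
  rewrite expr0n addr0; have := leh n x; have := u0 x.
  have : 0 <= h n x by [].
  set a := h n x; set b := u x; nra.
have [_ _ cvg0] := dominated_convergence measurableT m1 (measurable_cst _) cv ig bd.
have [n _ /(_ n (leqnn n)) hn] : \forall n \near \oo,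
    (\int[mu]_x (sqmod ((u x)%:C%C - (h n x)%:C%C))%:E < eps%:E)%E.
  apply: (cvg0 [set y | (y < eps%:E)%E]).
  by rewrite integral0; apply: open_ereal_lt'; rewrite lte_fin.
exists (fun x => (h n x)%:C%C) => //; split; [exact: muh|exact: cell_approx_nnsfun].
Qed.

Lemma cell_approx_L2 f : cmeas f -> (sqint mu f < +oo)%E -> cell_approx f.
Proof.
move=> mf fin; have [mf1 mf2] := mf.
have part (u : T -> K) : measurable_fun setT u -> (forall x, 0 <= u x) ->
    (forall x, u x ^+ 2 <= sqmod (f x)) -> cell_approx (fun x => (u x)%:C%C).
  move=> mU u0 uf; apply: cell_approx_nonneg => //; apply: le_lt_trans fin.
  apply: ge0_le_integral => //.
  - by move=> x _; rewrite lee_fin sqmod_ge0.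
  - by apply: measurable_sqmod; exact: cmeas_real.
  - exact: measurable_sqmod.
  - by move=> x _; rewrite lee_fin {1}/sqmod /= expr0n addr0.
have half (c : K) : measurable_fun [set: T] (fun x => Num.max 0 (c * complex.Re (f x))) /\
    measurable_fun [set: T] (fun x => Num.max 0 (c * complex.Im (f x))).
  have aux (v : T -> K) : measurable_fun [set: T] v ->
      measurable_fun [set: T] (fun x => Num.max 0 (c * v x)).
    move=> mv; apply: measurable_maxr; first exact: measurable_cst.
    by apply: measurable_funM => //; exact: measurable_cst.
  by split; exact: aux.
have sq_max (t s : K) : Num.max 0 t ^+ 2 <= t ^+ 2 + s ^+ 2.
  have [_|_] := leP 0 t; first by rewrite lerDl sqr_ge0.
  by rewrite expr0n addr_ge0 ?sqr_ge0.
(* c = 1 selects the positive part and c = -1 the negative part, of the real part in [pt] and of the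
   imaginary part in [qt]. *)
pose pt c x := (Num.max 0 (c * complex.Re (f x)))%:C%C : K[i].
pose qt c x := (Num.max 0 (c * complex.Im (f x)))%:C%C : K[i].
have mpt c : cmeas (pt c) by apply: cmeas_real; have [] := half c.
have mqt c : cmeas (qt c) by apply: cmeas_real; have [] := half c.
have ap c : c ^+ 2 = 1 -> cell_approx (pt c).
  move=> c2; apply: part => [|x|x]; [by have [] := half c|by rewrite le_max lexx|].
  by rewrite (le_trans (sq_max _ (complex.Im (f x))))// exprMn c2 mul1r.
have aq c : c ^+ 2 = 1 -> cell_approx (qt c).
  move=> c2; apply: part => [|x|x]; [by have [] := half c|by rewrite le_max lexx|].
  by rewrite (le_trans (sq_max _ (complex.Re (f x))))// exprMn c2 mul1r /sqmod addrC.
have aC c u : cmeas u -> cell_approx u -> cmeas (fun x => c * u x) /\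
    cell_approx (fun x => c * u x).
  move=> mu' au; split; last exact: cell_approxZ.
  by apply: cmeasM => //; exact: cmeas_cst.
have aD u v : cmeas u /\ cell_approx u -> cmeas v /\ cell_approx v ->
    cmeas (fun x => u x + v x) /\ cell_approx (fun x => u x + v x).
  by move=> [mu' au] [mv av]; split; [exact: cmeasD|exact: cell_approxD].
have s1 : (1 : K) ^+ 2 = 1 by rewrite expr1n.
have sN1 : (-1 : K) ^+ 2 = 1 by rewrite sqrrN expr1n.
have [_] := aD _ _ (aD _ _ (aC 1 _ (mpt 1) (ap _ s1)) (aC (-1) _ (mpt (-1)) (ap _ sN1)))
  (aD _ _ (aC 'i%C _ (mqt 1) (aq _ s1)) (aC (- 'i%C) _ (mqt (-1)) (aq _ sN1))).
congr cell_approx; apply/funext => x; rewrite /pt /qt.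
have maxE (t : K) : Num.max 0 (1 * t) - Num.max 0 (-1 * t) = t.
  by rewrite mul1r mulN1r; case: (leP 0 t) => t0; case: leP => ?; lra.
case: (f x) => a b /=; apply/eqP; rewrite eq_complex /=.
by apply/andP; split; apply/eqP; rewrite -[RHS]maxE; ring.
Qed.

End CellDensity.

(** * The contraction on cellwise functions *)

Section Contraction.
Variables (K : realType) (N R q : nat) (es : seq nat).
Hypotheses (N_gt1 : (1 < N)%N) (R_gt1 : (1 < R)%N).
Hypotheses (es_sorted : sorted ltn es) (es_ltq : forall e, e \in es -> (e < q)%N).
Variable mu : probability (measurableTypeR K) K.
Local Notation T := (measurableTypeR K).
Local Notation M := (base K N R q).
Local Notation digit_combs := (comb N (digit_steps N (1 : K) es)).
Local Notation us := (lev_us K N R q es).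
Local Notation bs := (lev_bs K N R q es).
Local Notation hull := (hull_bound K N R q).

Hypothesis muE : forall E : set T, measurable E ->
  (mu E = ((N ^ size es)%:R^-1)%:E *
         \sum_(d <- digit_combs) mu ((fun x : T => (M^-1 * (x + d))%R : T) @^-1` E))%E.

Let N_gt0 : (0 < N)%N := ltnW N_gt1.
Let M_gt0 : 0 < M := base_gt0 K q N_gt1 R_gt1.

Let mu_setT : mu [set: T] = 1%E. Proof. exact: probability_setT. Qed.

(** Phases that cover at most h turns lie, once recentred, within the angle pi h of 0; this is the
    least cosine there. *)
Definition min_cos : K := cos (pi * hull).
Let c0 := min_cos.

(* Positive because hull_bound < 1/2; this is where R > 1 enters. *)
Lemma min_cos_gt0 : 0 < c0.
Proof.
have p0 := pi_gt0 K.
have h0 := hull_bound_ge0 K q N_gt1 R_gt1; have h1 := hull_bound_lt K q N_gt1 R_gt1.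
apply: cos_gt0_pihalf; apply/andP; split; nra.
Qed.

Lemma min_cos_le1 : c0 <= 1.
Proof. exact: cos_le1. Qed.

Lemma min_cos_le (t : K) : `|t| <= hull / 2 -> c0 <= cos (2 * pi * t).
Proof.
move=> th; have p0 := pi_gt0 K.
have h0 := hull_bound_ge0 K q N_gt1 R_gt1; have h1 := hull_bound_lt K q N_gt1 R_gt1.
have cos_abs (x : K) : cos x = cos `|x|.
  by case: (leP 0 x) => x0; [rewrite ger0_norm|rewrite ltr0_norm// cosN].
rewrite cos_abs !normrM (gtr0_norm p0) (ger0_norm (ler0n K 2)) /c0 /min_cos.
have t0 := normr_ge0 t.
rewrite leNgt ltr_cos -?leNgt ?in_itv/=; first nra.
  by apply/andP; split; nra.
by apply/andP; split; nra.
Qed.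

(** The left side is 1 - 2 c cos + c^2 with cos >= c. Without the damping factor c the same argument
    would only give 2 - 2 c, which may exceed 1. *)
Lemma sqmod_damp (t : K) : `|t| <= hull / 2 ->
  sqmod (1 - c0%:C%C * cis t) <= 1 - c0 ^+ 2.
Proof.
move=> /min_cos_le h; rewrite /sqmod /= /cis /=.
have := cos2Dsin2 (2 * pi * t); have := min_cos_gt0.
move: h; set c := cos _; set s := sin _; nra.
Qed.

(** As h < 1, the copy x + M^-k [0, h] stays in the cell whose left end is x. *)
Let cell_sample k (g : T -> K[i]) x y : cellwise (R * N ^ q) k g ->
  x \in comb N (us k) -> 0 <= y <= hull -> g (x + (M ^+ k)^-1 * y) = g x.
Proof.
move=> cg /(comb_lev_us_nat _)[//|//|i ->] /andP[y0 y1].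
have h1 := hull_bound_lt K q N_gt1 R_gt1.
have := cg i y 0; rewrite addr0 [_^-1 * _]mulrC -mulrDl => -> //.
  by rewrite y0; lra.
by rewrite lexx ltr01.
Qed.

Let integral_ae_const (F : T -> K) (c : K) : measurable_fun [set: T] F ->
  (forall y, 0 <= F y) -> 0 <= c -> (forall y, 0 <= y <= hull -> F y = c) ->
  (\int[mu]_y (F y)%:E = c%:E)%E.
Proof.
move=> mF F0 c_ge0 Fc; transitivity (\int[mu]_y (cst c%:E y))%E.
  apply: ge0_ae_eq_integral => //; first exact/measurable_EFinP.
    by move=> y _; rewrite lee_fin.
  have := ae_hull N_gt1 R_gt1 es_sorted es_ltq muE.
  by apply: filterS => y hy _; rewrite Fc.
by rewrite integral_cst// -[RHS]mule1; congr (_ * _)%E; exact: mu_setT.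
Qed.

Lemma sqint_cellwise k (g : T -> K[i]) : cmeas g -> cellwise (R * N ^ q) k g ->
  sqint mu g = ((N ^ size (us k))%:R^-1 * \sum_(x <- comb N (us k)) sqmod (g x))%:E.
Proof.
move=> mg cg; rewrite /sqint (integral_level muE k)//.
- rewrite EFinM -sumEFin; congr (_ * _)%E; apply: eq_big_seq => x xc.
  apply: integral_ae_const; last 3 first.
  + by move=> y; exact: sqmod_ge0.
  + exact: sqmod_ge0.
  + by move=> y hy; rewrite (cell_sample cg).
  + apply: (measurableT_comp (f := fun z : T => sqmod (g z))).
      exact/measurable_EFinP/measurable_sqmod.
    exact: measurable_affine.
- exact: measurable_sqmod.
- by move=> x; rewrite lee_fin sqmod_ge0.
Qed.

Lemma cmeas_cis l : cmeas (fun x : T => cis (x * l) : K[i]).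
Proof.
have mlin : measurable_fun [set: T] (fun x : T => 2 * pi * (x * l) : T).
  apply: measurable_funM; first exact: measurable_cst.
  by apply: measurable_funM => //; exact: measurable_cst.
split; apply: measurableT_comp mlin => //.
- by apply: continuous_measurable_fun; exact: continuous_cos.
- by apply: continuous_measurable_fun; exact: continuous_sin.
Qed.

(* On the cell at x, g equals its discrete Fourier sum at the corner x; moving
   from x to x + M^-k y multiplies the mode l by a phase which, recentred at the
   midpoint of the hull, has real part at least [min_cos]. *)
Lemma cellwise_contraction k (g : T -> K[i]) : cmeas g -> cellwise (R * N ^ q) k g ->
  exists c : K -> K[i],
  (sqint mu (fun x => g x - \sum_(l <- comb N (bs k)) c l * cis (x * l))%R
     <= (1 - c0 ^+ 2)%:E * sqint mu g)%E.
Proof.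
move=> mg cg; have df := dual_frames_lev K N_gt1 R_gt1 es_sorted es_ltq k.
pose a := dft N (us k) g; pose Mk := (M ^+ k)^-1.
(* The Fourier coefficient of g, damped by [c0] and turned back by the phase that mode l acquires at
   the midpoint of the hull. *)
pose c l := a l * (c0%:C%C * cis (- (Mk * l * (hull / 2)))).
exists c; set h := fun x => _.
have mh : cmeas h.
  apply: cmeasB => //; apply: cmeas_sum => l.
  by apply: cmeasM; [exact: cmeas_cst|exact: cmeas_cis].
rewrite (sqint_cellwise mg cg) /sqint (integral_level muE k); last 2 first.
- exact: measurable_sqmod.
- by move=> x; rewrite lee_fin sqmod_ge0.
set S := \sum_(x <- _) sqmod (g x).
rewrite EFinM muleCA; apply: lee_wpmul2l; first by rewrite lee_fin invr_ge0.
rewrite -EFinM -ge0_integral_sum//; last 2 first.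
- move=> x; apply: (measurableT_comp (f := fun z : T => (sqmod (h z))%:E)).
    exact: measurable_sqmod.
  exact: measurable_affine.
- by move=> x y _; rewrite lee_fin sqmod_ge0.
have -> : (((1 - c0 ^+ 2) * S)%:E = \int[mu]_y (cst ((1 - c0 ^+ 2) * S)%:E y))%E.
  by rewrite integral_cst// -[LHS]mule1; congr (_ * _)%E; exact/esym/mu_setT.
(* For fixed y the errors at the points x + M^-k y form a Fourier sum in x with coefficients [b].
   Plancherel reduces the comparison with g to one factor per mode, which [sqmod_damp] bounds. *)
have key y : 0 <= y <= hull ->
    \sum_(x <- comb N (us k)) sqmod (h (x + Mk * y)) <= (1 - c0 ^+ 2) * S.
  move=> hy.
  pose b l := a l * (1 - c0%:C%C * cis (Mk * l * (y - hull / 2))).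
  have -> : \sum_(x <- comb N (us k)) sqmod (h (x + Mk * y)) =
      \sum_(x <- comb N (us k)) sqmod (\sum_(l <- comb N (bs k)) b l * cis (x * l)).
    apply: eq_big_seq => x xc; congr sqmod.
    rewrite /h (cell_sample cg xc hy) -(dft_inversion N_gt0 df g xc) -sumrB.
    apply: eq_bigr => l _; rewrite /b /c -/a.
    have -> : Mk * l * (y - hull / 2) = - (Mk * l * (hull / 2)) + Mk * y * l by ring.
    by rewrite mulrDl !cisD; ring.
  have -> : S = \sum_(x <- comb N (us k)) sqmod (\sum_(l <- comb N (bs k)) a l * cis (x * l)).
    by apply: eq_big_seq => x xc; rewrite (dft_inversion N_gt0 df g xc).
  rewrite !(plancherel N_gt0 df) mulrCA ler_wpM2l// mulr_sumr.
  rewrite big_seq [leRHS]big_seq; apply: ler_sum => l lc.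
  rewrite sqmodM mulrC ler_wpM2r ?sqmod_ge0// sqmod_damp//.
  have [i li ltM] := comb_lev_bs_nat N_gt1 R_gt1 es_sorted es_ltq lc.
  have l0 : 0 <= l by rewrite li.
  have Mk0 : 0 < M ^+ k by rewrite exprn_gt0.
  have lM0 : 0 <= Mk * l by rewrite mulr_ge0// invr_ge0 ltW.
  have lM1 : Mk * l <= 1 by rewrite mulrC ler_pdivrMr// mul1r ltW.
  have yh : `|y - hull / 2| <= hull / 2.
    by move: hy => /andP[? ?]; rewrite ler_norml; apply/andP; split; lra.
  rewrite normrM (ger0_norm lM0).
  by rewrite (le_trans (ler_wpM2r (normr_ge0 _) lM1))// mul1r.
apply: ae_ge0_le_integral => //.
- by move=> y _; apply: sume_ge0 => x _; rewrite lee_fin sqmod_ge0.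
- apply: emeasurable_sum => x.
  apply: (measurableT_comp (f := fun z : T => (sqmod (h z))%:E)).
    exact: measurable_sqmod.
  exact: measurable_affine.
- move=> y _; rewrite lee_fin mulr_ge0 ?sumr_ge0// => [|x _]; last exact: sqmod_ge0.
  have := min_cos_gt0; have := min_cos_le1; rewrite -/c0; nra.
- have := ae_hull N_gt1 R_gt1 es_sorted es_ltq muE.
  by apply: filterS => y hy _; rewrite sumEFin lee_fin key.
Qed.

End Contraction.

(** * From an approximate contraction to a dense span *)

Section ContractionDensity.
Variables (d : measure_display) (T : measurableType d) (K : realType).
Variables (mu : {measure set T -> \bar K}) (I : choiceType) (A : set I) (e : I -> T -> K[i]).
Implicit Types (f g h : T -> K[i]).

Hypothesis cmeas_e : forall i, cmeas (e i).

(** [uniq r] allows two combinations to be merged over [undup (r ++ s)] by adding coefficients. *)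
Definition in_span h := exists (r : seq I) (c : I -> K[i]),
  [/\ uniq r, forall i, i \in r -> A i & h = fun x => \sum_(i <- r) c i * e i x].

Lemma cmeas_span h : in_span h -> cmeas h.
Proof.
move=> [r [c [_ _ ->]]]; apply: cmeas_sum => i.
by apply: cmeasM => //; exact: cmeas_cst.
Qed.

Lemma big_uniq_extend (V : nmodType) (r s : seq I) (F : I -> V) : uniq r -> uniq s ->
  {subset r <= s} -> \sum_(i <- r) F i = \sum_(i <- s) if i \in r then F i else 0.
Proof.
move=> ur us rs; rewrite -big_mkcond -[RHS]big_filter; apply: perm_big.
apply: uniq_perm => //; first exact: filter_uniq.
by move=> i; rewrite mem_filter andb_idr// => /rs.
Qed.

Lemma in_spanD g h : in_span g -> in_span h -> in_span (fun x => g x + h x).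
Proof.
move=> [r [a [ur rA ->]]] [s [b [us sA ->]]].
pose t := undup (r ++ s).
exists t, (fun i => (if i \in r then a i else 0) + (if i \in s then b i else 0)).
split; first exact: undup_uniq.
  by move=> i; rewrite mem_undup mem_cat => /orP[/rA|/sA].
apply/funext => x.
rewrite (big_uniq_extend _ ur (undup_uniq (r ++ s))); last first.
  by move=> i ir; rewrite mem_undup mem_cat ir.
rewrite (big_uniq_extend _ us (undup_uniq (r ++ s))); last first.
  by move=> i ir; rewrite mem_undup mem_cat ir orbT.
rewrite -big_split; apply: eq_bigr => i _; rewrite mulrDl.
by congr (_ + _); case: ifP => // _; rewrite mul0r.
Qed.

Lemma in_span0 : in_span (fun=> 0).
Proof. by exists [::], (fun=> 0); split=> //; apply/funext => x; rewrite big_nil. Qed.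

Let finsq f := (sqint mu f < +oo)%E.

Let fineE f : finsq f -> sqint mu f = (fine (sqint mu f))%:E.
Proof. by move=> ff; rewrite fineK// ge0_fin_numE// sqint_ge0. Qed.

Let fine_ge0 f : 0 <= fine (sqint mu f).
Proof. exact/fine_ge0/sqint_ge0. Qed.

Variable (th : K).
Hypothesis th_ge0 : 0 <= th.
Hypothesis th_lt1 : th < 1.

Hypothesis contract : forall f, cmeas f -> finsq f -> forall eps : K, 0 < eps ->
  exists g, [/\ cmeas g, (sqint mu (fun x => f x - g x)%R < eps%:E)%E &
    exists2 h, in_span h & (sqint mu (fun x => g x - h x)%R <= th%:E * sqint mu g)%E].

(** Midway between th and 1: half of the gap pays for replacing f by an approximation. *)
Let rho := (1 + th) / 2.

Lemma contract_step f (eta : K) : cmeas f -> finsq f -> 0 < eta ->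
  exists2 h, in_span h &
    (sqint mu (fun x => f x - h x)%R <= (rho * fine (sqint mu f) + eta)%:E)%E.
Proof.
(* Passing from f to g and back costs the factor 1 + de twice; de is such that (1 + de)^2 th <= th +
   3 de = rho. *)
move=> mf ff eta0; pose de := (1 - th) / 6.
have de0 : 0 < de by rewrite divr_gt0// subr_gt0.
have di0 : 0 < 1 + de^-1 by rewrite ltr_wpDr ?invr_ge0// ltW.
(* The approximation error, weighted by 1 + 1/de, enters once directly and once with the factor (1 +
   de) th <= 2, so three times in all. *)
have et0 : 0 < eta / (3 * (1 + de^-1)) by rewrite divr_gt0// mulr_gt0.
have [g [mg fg [h sh gh]]] := contract mf ff et0.
exists h => //; have mh := cmeas_span sh.
have ffg : finsq (fun x => f x - g x) by rewrite /finsq (lt_trans fg)// ltry.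
have gf : (sqint mu g <= (1 + de)%:E * sqint mu f
    + (1 + de^-1)%:E * sqint mu (fun x => f x - g x)%R)%E.
  rewrite [X in (_ <= _ + _ * X)%E]sqintC.
  rewrite [X in sqint mu X](_ : g = fun x => f x + (g x - f x)); last first.
    by apply/funext => x; rewrite addrC subrK.
  by apply: sqintD_le => //; exact: cmeasB.
have fh : (sqint mu (fun x => f x - h x)%R <= (1 + de)%:E * sqint mu (fun x => g x - h x)%R
    + (1 + de^-1)%:E * sqint mu (fun x => f x - g x)%R)%E.
  rewrite (_ : (fun x => f x - h x) = (fun x => (g x - h x) + (f x - g x))); last first.
    by apply/funext => x; rewrite [RHS]addrC addrA subrK.
  by apply: sqintD_le => //; exact: cmeasB.
move: fg gf gh fh; rewrite (fineE ff) (fineE ffg) -!EFinM -EFinD lte_fin.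
set b := fine _; set a := fine _ => bl gf.
have fg : finsq g by rewrite /finsq (le_lt_trans gf)// ltry.
move: gf; rewrite (fineE fg) lee_fin -EFinM; set c := fine _ => cl gh.
have fgh : finsq (fun x => g x - h x) by rewrite /finsq (le_lt_trans gh)// ltry.
move: gh; rewrite (fineE fgh) -EFinM -EFinD lee_fin; set u := fine _ => ul fh.
apply: (le_trans fh); rewrite lee_fin.
have a0 : 0 <= a := fine_ge0 _; have b0 : 0 <= b := fine_ge0 _.
have b1 : 3 * ((1 + de^-1) * b) <= eta.
  by move: (ltW bl); rewrite ler_pdivlMr ?mulr_gt0//; lra.
have de1 : de <= 1 by rewrite /de; move: th_ge0; lra.
have w0 : 0 <= (1 + de^-1) * b by rewrite mulr_ge0// ltW.
move: b1 cl w0; set w := (1 + de^-1) * b => b1 cl w0.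
have u1 : u <= th * ((1 + de) * a + w) by apply: (le_trans ul); rewrite ler_wpM2l.
have u2 : (1 + de) * u <= (1 + de) * (th * ((1 + de) * a + w)).
  by rewrite ler_wpM2l// addr_ge0// ltW.
have s1 : (1 + de) * (th * (1 + de)) <= rho.
  have -> : rho = th + 3 * de by rewrite /rho /de; field.
  have : th * (2 * de + de ^+ 2) <= 3 * de.
    have : 0 <= 2 * de + de ^+ 2 by rewrite addr_ge0 ?sqr_ge0// mulr_ge0// ltW.
    by move: th_ge0 th_lt1; nra.
  by lra.
have s2 : (1 + de) * th <= 2 by move: th_ge0 th_lt1; nra.
move: u2 b1 (ler_wpM2r a0 s1) (ler_wpM2r w0 s2).
rewrite /=; move: (rho) (de) => rh dd; lra.
Qed.

(** The error of the first step is only multiplied by rho^n <= 1 afterwards, so giving half of eta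
    to it and half to the remaining steps suffices. *)
Lemma contract_iter n f (eta : K) : cmeas f -> finsq f -> 0 < eta ->
  exists2 h, in_span h &
    (sqint mu (fun x => f x - h x)%R <= (rho ^+ n * fine (sqint mu f) + eta)%:E)%E.
Proof.
have rho0 : 0 <= rho by rewrite divr_ge0// addr_ge0.
have rho1 : rho <= 1 by rewrite /rho; move: th_lt1; lra.
elim: n f eta => [|n IH] f eta mf ff eta0.
  exists (fun=> 0); first exact: in_span0.
  under eq_fun do rewrite subr0.
  by rewrite (fineE ff) lee_fin expr0 mul1r lerDl ltW.
have e2 : 0 < eta / 2 by rewrite divr_gt0.
have [h1 s1 l1] := contract_step mf ff e2.
have m1 : cmeas (fun x => f x - h1 x) by apply: cmeasB => //; exact: cmeas_span.
have f1 : finsq (fun x => f x - h1 x) by rewrite /finsq (le_lt_trans l1)// ltry.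
have [h2 s2 l2] := IH _ _ m1 f1 e2.
exists (fun x => h1 x + h2 x); first exact: in_spanD.
rewrite (_ : (fun x => f x - (h1 x + h2 x)) = (fun x => f x - h1 x - h2 x)); last first.
  by apply/funext => x; rewrite opprD addrA.
apply: (le_trans l2); move: l1; rewrite (fineE f1) !lee_fin => l1.
have r0 : 0 <= rho ^+ n by rewrite exprn_ge0.
have r1 : rho ^+ n <= 1 by rewrite exprn_ile1.
have := ler_wpM2l r0 l1; rewrite exprSr mulrDr mulrA.
have : rho ^+ n * (eta / 2) <= eta / 2 by rewrite ler_piMl// ltW.
lra.
Qed.

Lemma span_dense f (eps : K) : cmeas f -> finsq f -> 0 < eps ->
  exists2 h, in_span h & (sqint mu (fun x => f x - h x)%R < eps%:E)%E.
Proof.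
move=> mf ff e0; set Q := fine (sqint mu f).
have rho0 : 0 <= rho by rewrite divr_ge0// addr_ge0.
have rho1 : rho < 1 by rewrite /rho; move: th_lt1; lra.
have [n hn] : exists n, rho ^+ n * Q < eps / 2.
  have : rho ^+ n * Q @[n --> \oo] --> 0 * Q.
    by apply: cvgM; [apply: cvg_expr; rewrite ger0_norm|exact: cvg_cst].
  rewrite mul0r => /(_ [set y | y < eps / 2]) cvg0.
  have [n _ /(_ n (leqnn n)) hn] : \forall n \near \oo, rho ^+ n * Q < eps / 2.
    by apply: cvg0; apply: lt_nbhsl; rewrite divr_gt0.
  by exists n.
have e2 : 0 < eps / 2 by rewrite divr_gt0.
have [h sh lh] := contract_iter n mf ff e2.
exists h => //; apply: (le_lt_trans lh); rewrite lte_fin -/Q; lra.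
Qed.

End ContractionDensity.

(** * Comparison of square integrals with the L2 norm *)

Lemma normL2E d (T : measurableType d) (K : realType) (mu : {measure set T -> \bar K})
  (f : T -> K[i]) : (normL2 mu f = sqint mu f `^ 2^-1)%E.
Proof.
rewrite /normL2 unlock; congr (_ `^ _)%E; apply: eq_integral => x _.
rewrite abse_EFin poweR_EFin; congr EFin.
case: (f x) => a b /=; rewrite /sqmod /= ger0_norm ?sqrtr_ge0//.
by rewrite powR_mulrn ?sqrtr_ge0// sqr_sqrtr// addr_ge0 ?sqr_ge0.
Qed.

Lemma normL2_lt d (T : measurableType d) (K : realType) (mu : {measure set T -> \bar K})
  (f : T -> K[i]) (eps : K) : 0 < eps ->
  (sqint mu f < (eps ^+ 2)%:E)%E -> (normL2 mu f < eps%:E)%E.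
Proof.
move=> e0 h; rewrite normL2E; have h0 := sqint_ge0 mu f.
have fin : sqint mu f \is a fin_num by rewrite ge0_fin_numE// (lt_trans h)// ltry.
move: h h0; rewrite -(fineK fin) poweR_EFin !lte_fin lee_fin => h h0.
have -> : eps = (eps ^+ 2) `^ 2^-1 by rewrite -powR_mulrn ?ltW// -powRrM divff// powRr1// ltW.
by rewrite gt0_ltr_powR// ?nnegrE ?sqr_ge0// invr_gt0.
Qed.

Lemma normL2_lty d (T : measurableType d) (K : realType) (mu : {measure set T -> \bar K})
  (f : T -> K[i]) : (normL2 mu f < +oo)%E <-> (sqint mu f < +oo)%E.
Proof.
rewrite normL2E; have := sqint_ge0 mu f; case: (sqint mu f) => [r| |] //= _.
by rewrite !ltry.
by rewrite invr_eq0 pnatr_eq0 /= !ltxx.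
Qed.

Lemma inL2P d (T : measurableType d) (K : realType) (mu : {measure set T -> \bar K})
  (f : T -> K[i]) : inL2 mu f <-> cmeas f /\ (sqint mu f < +oo)%E.
Proof.
by split=> [[h1 h2 /normL2_lty h3]|[[h1 h2] /normL2_lty h3]]; split.
Qed.

Lemma character_funE (K : realType) (l x : K) : character_fun l x = cis (x * l).
Proof. by rewrite /character_fun /cis -mulrA [l * x]mulrC. Qed.

(** * Orthonormality, completeness and compact support *)

Section Spectrum.
Variables (K : realType) (N R q : nat) (es : seq nat).
Hypotheses (N_gt1 : (1 < N)%N) (R_gt1 : (1 < R)%N).
Hypotheses (es_sorted : sorted ltn es) (es_ltq : forall e, e \in es -> (e < q)%N).
Variable mu : probability (measurableTypeR K) K.
Local Notation T := (measurableTypeR K).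
Local Notation M := (base K N R q).
Local Notation digit_combs := (comb N (digit_steps N (1 : K) es)).
Local Notation us := (lev_us K N R q es).
Local Notation bs := (lev_bs K N R q es).
Local Notation hull := (hull_bound K N R q).

Hypothesis muE : forall E : set T, measurable E ->
  (mu E = ((N ^ size es)%:R^-1)%:E *
         \sum_(d <- digit_combs) mu ((fun x : T => (M^-1 * (x + d))%R : T) @^-1` E))%E.

Let N_gt0 : (0 < N)%N := ltnW N_gt1.
Let mu_setT : mu [set: T] = 1%E. Proof. exact: probability_setT. Qed.

Definition frequencies : set K := [set l | exists k, l \in comb N (bs k)].

Lemma comb0 (cs : seq K) : 0 \in comb N cs.
Proof.
elim: cs => [|c cs IH]; first by rewrite inE.
by apply/combP; exists 0%N, 0; rewrite mulr0 addr0.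
Qed.

(** Padding with zero digits makes the levels increase, so any two frequencies share a level. *)
Lemma comb_lev_bs_le k k' l : (k <= k')%N -> l \in comb N (bs k) -> l \in comb N (bs k').
Proof.
move=> /subnKC <-; elim: (k' - k)%N => [|j IH]; first by rewrite addn0.
by move=> /IH h; rewrite addnS /= -[l]add0r mem_comb_cat// comb0.
Qed.

Lemma frequencies_nat l : frequencies l -> exists n : nat, l = n%:R.
Proof.
by move=> [k /(comb_lev_bs_nat N_gt1 R_gt1 es_sorted es_ltq)[n ->]]; exists n.
Qed.

Lemma countable_frequencies : countable frequencies.
Proof.
apply: (@sub_countable _ _ _ (range (fun n : nat => n%:R : K))).
  by apply: subset_card_le => l /frequencies_nat[n ->]; exists n.
exact: card_image_le.
Qed.

Lemma isolated_frequencies : frequencies `<=` isolated frequencies.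
Proof.
move=> l fl; split; first exact/mem_set.
exists (ball l 1); first exact: nbhsx_ballx.
have [n en] := frequencies_nat fl.
apply/seteqP; split=> [x [+ /frequencies_nat[i ei]]|_ ->]; last first.
  by split=> //; exact: ballxx.
rewrite /ball /= en ei => h; congr (_%:R); apply/eqP; rewrite eqn_leq.
move: h; rewrite ltr_norml => /andP[h1 h2]; apply/andP; split.
  by rewrite -ltnS -(ltr_nat K) -natr1; lra.
by rewrite -ltnS -(ltr_nat K) -natr1; lra.
Qed.

(** [integral_level] handles nonnegative functions; the added 1 brings F into its scope and is
    removed again in [Rintegral_eq0_level]. *)
Lemma integral_level_mean0 k (F : K -> K) : (forall x, -1 <= F x) ->
  measurable_fun [set: T] (F : T -> K) ->
  (forall z, \sum_(x <- comb N (us k)) F (x + z) = 0) ->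
  (\int[mu]_x (1 + F x)%:E = 1)%E.
Proof.
move=> F1 mF F0.
have nn x : (0 <= (1 + F x)%:E)%E by rewrite lee_fin; have := F1 x; lra.
have mF1 : measurable_fun [set: T] (fun x : T => (1 + F x)%:E).
  by apply/measurable_EFinP; apply: measurable_funD => //; exact: measurable_cst.
rewrite (integral_level muE k mF1 nn) -ge0_integral_sum//; last first.
  by move=> x; apply: (measurableT_comp mF1); exact: measurable_affine.
under eq_integral => y _.
  rewrite sumEFin big_split /= F0 addr0 big_const_seq count_predT iter_addr_0 size_comb.
  over.
rewrite integral_cst//.
rewrite (_ : ((N ^ size (us k))%:R%:E * mu [set: T] = (N ^ size (us k))%:R%:E)%E).
  by rewrite -EFinM mulVf// pnatr_eq0 expn_eq0 gtn_eqF.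
by rewrite -[RHS]mule1; congr (_ * _)%E; exact: mu_setT.
Qed.

Lemma Rintegral_eq0_level k (F : K -> K) : (forall x, `|F x| <= 1) ->
  measurable_fun [set: T] (F : T -> K) ->
  (forall z, \sum_(x <- comb N (us k)) F (x + z) = 0) ->
  \int[mu]_x F x = 0.
Proof.
move=> F1 mF F0.
have iF : mu.-integrable [set: T] (EFin \o F).
  apply: measurable_bounded_integrable => //.
    by rewrite (le_lt_trans (probability_le1 _ _)) ?ltry.
  exists 1; split=> // r r1 x _; apply: le_trans (F1 x) (ltW r1).
have Fm1 x : -1 <= F x by have := F1 x; rewrite ler_norml => /andP[].
have := integral_level_mean0 Fm1 mF F0.
under eq_integral do rewrite EFinD.
rewrite integralD//=; last exact: finite_measure_integrable_cst.
have -> : (\int[mu]_x 1%:E = 1)%E.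
  by rewrite integral_cst// mul1e; exact: mu_setT.
have fin := integrable_fin_num measurableT iF.
rewrite /Rintegral; move: fin; rewrite /comp; case: (integral _ _ _) => //= r _ [].
by move=> h; rewrite -[r](addrK 1) [r + 1]addrC h subrr.
Qed.

Lemma cmeas_character l : cmeas (character_fun l : T -> K[i]).
Proof.
rewrite (_ : character_fun l = fun x => cis (x * l)); first exact: cmeas_cis.
by apply/funext => x; rewrite character_funE.
Qed.

Lemma sqint_character l : sqint mu (character_fun l : T -> K[i]) = 1%E.
Proof.
rewrite /sqint; under eq_integral do rewrite character_funE sqmod_cis.
by rewrite integral_cst// mul1e; exact: mu_setT.
Qed.

(** At a level containing both frequencies the Gram sum over the points vanishes, and a translation
    z of the points only contributes a common phase; averaging over the copies of the measure then
    gives 0. *)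
Lemma dotL2_character l l' : frequencies l -> frequencies l' ->
  dotL2 mu (character_fun l) (character_fun l') = (l == l')%:R.
Proof.
move=> [k0 lc0] [k1 lc1]; pose k := maxn k0 k1.
have lc : l \in comb N (bs k) := comb_lev_bs_le (leq_maxl _ _) lc0.
have l'c : l' \in comb N (bs k) := comb_lev_bs_le (leq_maxr _ _) lc1.
rewrite /dotL2.
have hE x : character_fun l x * (character_fun l' x)^*%C = cis (x * (l - l')).
  by rewrite !character_funE cisM_conj mulrBr.
under eq_Rintegral do rewrite hE.
under [X in Complex _ X]eq_Rintegral do rewrite hE.
have [->|ll'] := eqVneq l l'.
  under eq_Rintegral do rewrite subrr mulr0 cis0 /=.
  under [X in Complex _ X]eq_Rintegral do rewrite subrr mulr0 cis0 /=.
  rewrite /Rintegral !integral_cst//=.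
  rewrite (_ : (1%:E * mu [set: T])%E = 1%E); last by rewrite mul1e; exact: mu_setT.
  by rewrite mul0e.
have [m1 m2] := cmeas_cis (l - l').
have F0 z : \sum_(x <- comb N (us k)) cis ((x + z) * (l - l')) = 0.
  under eq_bigr do rewrite mulrDl cisD.
  rewrite -mulr_suml (dual_frames_gram (dual_frames_lev K N_gt1 R_gt1 es_sorted es_ltq k) lc l'c).
  by rewrite (negPf ll') !mul0r.
rewrite (@Rintegral_eq0_level k _ _ m1) ?(@Rintegral_eq0_level k _ _ m2)//.
- by move=> x; exact: sin_max.
- by move=> z; have := congr1 (@complex.Im K) (F0 z); rewrite raddf_sum.
- by move=> x; exact: cos_max.
- by move=> z; have := congr1 (@complex.Re K) (F0 z); rewrite raddf_sum.
Qed.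

Lemma spectrum_frequencies : is_spectrum mu frequencies.
Proof.
split; [exact: countable_frequencies|exact: isolated_frequencies|split].
- move=> l _; apply/inL2P; split; first exact: cmeas_character.
  by rewrite sqint_character ltry.
- exact: dotL2_character.
move=> f /inL2P[mf ff] eps e0.
have e2 : 0 < eps ^+ 2 by rewrite exprn_gt0.
have c0 := min_cos_gt0 K q N_gt1 R_gt1; have c1 := min_cos_le1 K N R q.
have th0 : 0 <= 1 - min_cos K N R q ^+ 2 by nra.
have th1 : 1 - min_cos K N R q ^+ 2 < 1 by nra.
have m1 : (1 < R * N ^ q)%N by rewrite -(ltr_nat K); exact: base_gt1.
have [|h [r [c [_ rA ->]]] fh] :=
    span_dense (A := frequencies) cmeas_character th0 th1 _ mf ff e2.
  (* The level k depends on g and eta, whereas the contraction factor does not. *)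
  move=> g mg fg eta eta0; have [k [u [mu' cu gu]]] := cell_approx_L2 m1 mg fg eta0.
  exists u; split=> //.
  have [c hc] := cellwise_contraction N_gt1 R_gt1 es_sorted es_ltq muE mu' cu.
  eexists; last exact: hc.
  exists (comb N (bs k)), c; split.
  - exact: (dual_frames_uniqr N_gt0 (dual_frames_lev K N_gt1 R_gt1 es_sorted es_ltq k)).
  - by move=> l lc; exists k.
  - by apply/funext => x; apply: eq_bigr => l _; rewrite character_funE.
by exists r, c; split=> //; exact: normL2_lt.
Qed.

(** The support is closed, and it avoids the complement of [0, h], an open null set. *)
Lemma compact_measure_support : compact (measure_support mu).
Proof.
have sub : measure_support mu `<=` `[0, hull]%classic.
  move=> x sx; rewrite /= in_itv/=; apply: contrapT => /negP nx.
  have oU : open (~` `[0, hull]%classic : set K).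
    by apply: closed_openC; exact: itv_closed.
  have := sx _ oU; rewrite (measure_outside_hull N_gt1 R_gt1 es_sorted es_ltq muE).
  - by rewrite ltxx => h; apply: notF; apply: h; rewrite /= in_itv/=; exact/negP.
  - by apply: measurableC; exact: measurable_itv.
  - by move=> y; rewrite /= in_itv/= => /negP.
apply: (subclosed_compact _ (@segment_compact K 0 hull) sub).
rewrite -(setCK (measure_support mu)); apply: open_closedC.
rewrite openE => x /= nx.
have [U [oU Ux mU]] : exists U : set K, [/\ open U, U x & ~ (0 < mu U)%E].
  apply: contrapT => h; apply: nx => U oU Ux; apply: contrapT => mU.
  by apply: h; exists U.
apply: filterS (open_nbhs_nbhs (conj oU Ux)).
by move=> y Uy sy; apply: mU; exact: sy.
Qed.

End Spectrum.

(** * Translation to the finite sets D and L and to the set Lambda *)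

Section DigitSets.
Variables (K : realType) (N : nat).
Hypothesis N_gt0 : (0 < N)%N.
Implicit Types (cs us bs : seq K).

Definition digit_parts cs : seq {fset K} := [seq dilate c (digits K N) | c <- cs].

Lemma digitsP (x : K) : reflect (exists2 k, (k < N)%N & x = k%:R) (x \in digits K N).
Proof.
rewrite /digits; apply: (iffP (imfsetP _ _ _ _)) => [[k /=]|[k kN ->]].
  by rewrite mem_iota => kN ->; exists k.
by exists k => //=; rewrite mem_iota.
Qed.

Lemma dilateP (c x : K) (A : {fset K}) :
  reflect (exists2 a, a \in A & x = c * a) (x \in dilate c A).
Proof. exact: (imfsetP _ _ _ _). Qed.

Lemma mem_sumsets cs x : (x \in sumsets (digit_parts cs)) = (x \in comb N cs).
Proof.
elim: cs x => [|c cs IH] x; first by rewrite !inE.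
rewrite /= /sumset; apply/imfset2P/combP => [[a /dilateP[b /digitsP[k kN ->] ->] [y]]|[k [y [kN yc ->]]]].
  by rewrite /= IH => yc ->; exists k, y.
exists (c * k%:R); first by apply/dilateP; exists k%:R => //; apply/digitsP; exists k.
by exists y; rewrite //= IH.
Qed.

Lemma directs_digit_partsl us bs : dual_frames N us bs -> directs (digit_parts us).
Proof.
elim: us bs => [|a us IH] [|b bs]// df; split; last by apply: IH; case: df => _ _; exact.
move=> _ _ x x' /dilateP[_ /digitsP[k kN ->] ->] /dilateP[_ /digitsP[k' k'N ->] ->].
rewrite !mem_sumsets => xc x'c e.
by have [-> ->] := dual_frames_injl df kN k'N xc x'c e.
Qed.

Lemma directs_digit_partsr us bs : dual_frames N us bs -> directs (digit_parts bs).
Proof.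
elim: us bs => [|a us IH] [|b bs]// df; split; last by apply: IH; case: df => _ _; exact.
move=> _ _ x x' /dilateP[_ /digitsP[k kN ->] ->] /dilateP[_ /digitsP[k' k'N ->] ->].
rewrite !mem_sumsets => xc x'c e.
by have [-> ->] := dual_frames_injr N_gt0 df kN k'N xc x'c e.
Qed.

(** Lets sums over the finite set, and its cardinality, be read off the list. *)
Lemma perm_sumsets cs : uniq (comb N cs) ->
  perm_eq (enum_fset (sumsets (digit_parts cs))) (comb N cs).
Proof.
by move=> ucs; apply: uniq_perm => [|//|x]; [exact: fset_uniq|exact: mem_sumsets].
Qed.

End DigitSets.

Section FrequencySet.
Variables (K : realType) (N R q : nat) (es : seq nat).
Hypothesis N_gt1 : (1 < N)%N.
Local Notation M := (base K N R q).
Local Notation L := (dilate M (sumsets (digit_parts N (freq_steps N (1 : K) es)))).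

Let freq_step k (z : K) : z \in comb N (freq_steps N (M ^+ k.+1) es) ->
  exists2 l, l \in L & z = M ^+ k * l.
Proof.
rewrite freq_stepsE comb_mul => /mapP[w wc ->]; exists (M * w).
  by apply/dilateP; exists w; rewrite ?mem_sumsets.
by rewrite exprSr mulrA.
Qed.

Lemma comb_lev_bsP k (x : K) : x \in comb N (lev_bs K N R q es k) <->
  exists l : nat -> K, (forall j, (1 <= j <= k)%N -> l j \in L) /\
    x = \sum_(1 <= j < k.+1) M ^+ (j - 1) * l j.
Proof.
elim: k x => [|k IH] x.
  rewrite inE; split=> [/eqP ->|[l [_ ->]]]; last by rewrite big_geq.
  by exists (fun=> 0); split=> [[]//|]; rewrite big_geq.
split=> [/comb_catP[y [z [/freq_step[u uL ->] /IH[l [lL ->]] ->]]]|[l [lL ->]]].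
  (* The block in front of [lev_bs k] carries the factor M^(k+1) and yields the top term M^k l of
     index k + 1. *)
  exists (fun j => if j == k.+1 then u else l j); split.
    move=> j /andP[j0 jk]; case: eqP => // /eqP jk'; apply: lL.
    by rewrite j0 -ltnS ltn_neqAle jk' jk.
  rewrite [RHS]big_nat_recr//= eqxx subn1 /= addrC; congr (_ + _).
  by apply: eq_big_nat => j /andP[_ jk]; rewrite ltn_eqF.
rewrite big_nat_recr//= addrC subn1 /=; apply: mem_comb_cat; last first.
  by apply/IH; exists l; split=> // j /andP[j0 jk]; apply: lL; rewrite j0 ltnW.
have /dilateP[w + ->] : l k.+1 \in L by apply: lL; rewrite leqnn.
rewrite mem_sumsets (freq_stepsE _ _ (M ^+ k.+1)) comb_mul => wc.
by apply/mapP; exists w; rewrite // exprSr mulrA.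
Qed.

Lemma frequenciesE : frequencies N R q es =
  [set x : K | exists (k : nat) (l : nat -> K),
    [/\ (1 <= k)%N, forall j, (1 <= j <= k)%N -> l j \in L &
        x = \sum_(1 <= j < k.+1) M ^+ (j - 1) * l j]].
Proof.
apply/seteqP; split=> x /=.
  (* Going up one level secures k >= 1; it also covers level 0, which holds only the frequency 0. *)
  move=> [k /(comb_lev_bs_le N_gt1 (leqnSn k))/comb_lev_bsP[l [lL ->]]].
  by exists k.+1, l.
move=> [k [l [_ lL ->]]]; exists k; apply/comb_lev_bsP; by exists l.
Qed.

End FrequencySet.

Local Open Scope ring_scope.

Theorem theorem1p1 (K : realType) (s R N q : nat) (p : 'I_s -> nat)
    (s_ge1 : (1 <= s)%N) (R_gt1 : (1 < R)%N) (N_gt1 : (1 < N)%N)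
    (coRN : coprime R N)
    (p_gt0 : forall i, (0 < p i)%N)
    (p_inc : forall i j : 'I_s, (i < j)%N -> (p i < p j)%N)
    (p_ltq : forall i, (p i < q)%N) :
  let M : K := (R * N ^ q)%N%:R in
  let exponents := 0%N :: codom p in
  let Dparts := [seq dilate (N%:R ^+ e) (digits K N) | e <- exponents] in
  let Lparts := [seq dilate (N%:R ^- e.+1) (digits K N) | e <- exponents] in
  let D := sumsets Dparts in
  let L := dilate M (sumsets Lparts) in
  let Lambda := [set x : K | exists (k : nat) (l : nat -> K),
        [/\ (1 <= k)%N,
            forall j, (1 <= j <= k)%N -> l j \in L &
            x = \sum_(1 <= j < k.+1) M ^+ (j - 1) * l j]] in
  [/\ directs Dparts,
      directs Lparts &
      forall mu : probability (measurableTypeR K) K,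
        self_similar_measure M D mu ->
        spectral_measure mu /\ is_spectrum mu Lambda].
Proof.
move=> M exponents Dparts Lparts D L Lambda.
have N_gt0 : (0 < N)%N := ltnW N_gt1.
have es_ltq e : e \in exponents -> (e < q)%N.
  rewrite inE => /orP[/eqP ->|/codomP[i ->]]; last exact: p_ltq.
  (* The exponent 0 is below q because s >= 1 supplies some p i < q. *)
  by apply: leq_ltn_trans (p_ltq (Ordinal s_ge1)).
have es_sorted : sorted ltn exponents.
  rewrite /= (path_sortedE ltn_trans); apply/andP; split.
    by apply/allP => e /codomP[i ->]; exact: p_gt0.
  rewrite sorted_pairwise; last exact: ltn_trans.
  rewrite /codom /image_mem pairwise_map.
  have : pairwise ltn [seq val i | i <- enum 'I_s].
    by rewrite val_enum_ord -sorted_pairwise ?iota_ltn_sorted//; exact: ltn_trans.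
  rewrite pairwise_map; apply: sub_pairwise => i j; exact: p_inc.
have DE : Dparts = digit_parts N (digit_steps N 1 exponents).
  rewrite /digit_parts /digit_steps -map_comp; apply: eq_map => e /=.
  by rewrite invr1 mul1r.
have LE : Lparts = digit_parts N (freq_steps N 1 exponents).
  rewrite /digit_parts /freq_steps -map_comp; apply: eq_map => e /=.
  by rewrite mul1r.
(* Both direct sums come from this single duality, between D and L / M. *)
have df : dual_frames N (digit_steps N (1 : K) exponents) (freq_steps N 1 exponents).
  rewrite -[digit_steps _ _ _]cats0 -[freq_steps _ _ _]cats0.
  by apply: dual_frames_cat => //; exact: oner_neq0.
split.
- by rewrite DE; exact: directs_digit_partsl df.
- by rewrite LE; exact: (directs_digit_partsr N_gt0 df).
move=> mu muD.
have perm := perm_sumsets (dual_frames_uniql df).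
have muE (E : set (measurableTypeR K)) : measurable E ->
    (mu E = ((N ^ size exponents)%:R^-1)%:E *
      \sum_(d <- comb N (digit_steps N (1 : K) exponents))
        mu ((fun x : measurableTypeR K => ((base K N R q)^-1 * (x + d))%R
              : measurableTypeR K) @^-1` E))%E.
  move=> mE; rewrite (muD E mE) /D DE (perm_big _ perm); congr (_%:R^-1%:E * _)%E.
  by rewrite (perm_size perm) size_comb size_map.
have spec : is_spectrum mu Lambda.
  rewrite /Lambda /L LE -(frequenciesE _ _ _ _ N_gt1).
  exact: spectrum_frequencies.
split=> //; split; last by exists Lambda.
exact: (compact_measure_support N_gt1 R_gt1 es_sorted es_ltq muE).
Qed.
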